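(* Let $X$ be a compact Kähler manifold of dimension $n$ with Kähler metric $h$, let $p\in X$, let $\mu : \widehat X \to X$ be the blowup of $X$ at $p$ with exceptional divisor $E$, and let $h_t = \mu^*h + t b$, where $b$ is the Hermitian form on $\widehat X$ described in the context. Let $q \in E$. Then for all small enough $t>0$ the holomorphic sectional curvature of $h_t$ is negative in some tangent directions at $q$; that is, there is $t_0>0$ such that for every $0<t<t_0$ there is a nonzero $\xi \in T_{\widehat X,q}$ with $H_{h_t}(\xi) < 0$.
   Context: Curvature conventions. For a Kähler metric $g$ with coefficients $g_{j\bar k} = g(\partial_j, \overline{\partial_k})$ in local holomorphic coordinates, the curvature tensor $R_g(\alpha,\overline\beta,\gamma,\overline\delta)$ of its Chern connection is normalized by $R_{j\bar k l\bar m} = -\partial_j \partial_{\bar k} g_{l\bar m} + \sum_{a,c} g^{a \bar c}\, \partial_j g_{l\bar c}\, \partial_{\bar k} g_{a\bar m}$. The holomorphic sectional curvature is $H_g(\xi) = R_g(\xi,\overline\xi,\xi,\overline\xi)/|\xi|_g^4$ for $\xi \neq 0$. The Hermitian form associated to a real $(1,1)$-form $\frac{i}{2}\sum b_{j\bar k}\, dz_j\wedge d\bar z_k$ is the one with coefficients $b_{j\bar k}$. With these conventions the Fubini–Study metric given by $\frac i2 \partial\bar\partial \log|v|^2$ has constant holomorphic sectional curvature $2$. The form $b$. Choose any holomorphic coordinate chart of $X$ around $p$, identified with a neighborhood of the origin in a complex vector space $V$ of dimension $n$ with $p$ corresponding to $0$. Over this chart the blowup is identified with an open subset of $\{(v,[w])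 \in V \times \mathbf P(V) \mid v \in \mathbf C w\}$, with $\mu$ the first projection and $E = \{0\}\times\mathbf P(V)$. Pick any inner product on $V$, with norm $|\cdot|$, and a ball $B(r)\subset V$ of radius $r$ centered at $0$ that fits into the chart. The form $\frac i2 \partial\bar\partial \log |v|^2$ on $V\setminus\{0\}$ descends to the Fubini–Study form on $\mathbf P(V)$. Then $b$ is the Hermitian form associated to a closed real smooth $(1,1)$-form on $\widehat X$, constructed by means of a bump function that is supported in the chart and identically $1$ on $B(r)$, which over $B(r)$ equals the pullback of this Fubini–Study form by the second projection and which vanishes outside the chart; in particular its restriction to $E$ is the Fubini–Study metric. For all small enough $t>0$, $h_t = \mu^*h + tb$ is a Kähler metric on $\widehat X$.
   Formalization: The formal theorem assumes dimension n ≥ 2; for n = 1 the blowup is the identity, b vanishes near E, and the claim fails, e.g. for the projective line with the Fubini–Study metric. *)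

(* Defs.v *)
From HB Require Import structures.
From mathcomp Require Export all_boot all_order all_algebra.
From mathcomp Require Export complex.
From mathcomp Require Export all_classical all_reals all_analysis.

Set Implicit Arguments.
Unset Strict Implicit.
Unset Printing Implicit Defensive.

Import Order.TTheory GRing.Theory Num.Theory.
Import numFieldNormedType.Exports.

Local Open Scope classical_set_scope.
Local Open Scope ring_scope.
Local Open Scope complex_scope.
Local Open Scope sesquilinear_scope.

(** * Calculus on open subsets of C^n

    C^n is carried by the real normed module R^n * R^n, the pair (x, y) standing
    for x + iy; this gives access to the library's topology, [differentiable] and
    ['D_v].  [zvec] is the corresponding complex row vector. *)

Notation Cn R n := ('rV[R]_n * 'rV[R]_n)%type.

Section Calculus.
Context {R : realType}.
Implicit Types n m : nat.

Definition zvec {n} (u : Cn R n) : 'rV[R[i]]_n :=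
  \row_j (u.1 0 j +i* u.2 0 j).

Fixpoint Ck {n} (k : nat) (U : set (Cn R n)) (f : Cn R n -> R) : Prop :=
  match k with
  | 0 => forall u, U u -> {for u, continuous f}
  | k'.+1 => (forall u, U u -> differentiable f u) /\
             (forall v : Cn R n, Ck k' U (fun u => 'D_v f u))
  end.

Definition smooth {n} (U : set (Cn R n)) (f : Cn R n -> R) : Prop :=
  forall k, Ck k U f.

Definition csmooth {n} (U : set (Cn R n)) (f : Cn R n -> R[i]) : Prop :=
  smooth U (fun u => complex.Re (f u)) /\ smooth U (fun u => complex.Im (f u)).

Definition cD {n} (v : Cn R n) (f : Cn R n -> R[i]) (u : Cn R n) : R[i] :=
  'D_v (fun w => complex.Re (f w)) u +i* 'D_v (fun w => complex.Im (f w)) u.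

(** The Wirtinger operators d/dz_j and d/d(conj z_j). *)
Definition dz {n} (j : 'I_n) (f : Cn R n -> R[i]) (u : Cn R n) : R[i] :=
  2^-1 * (cD (delta_mx 0 j, 0) f u - 'i%C * cD (0, delta_mx 0 j) f u).

Definition dzb {n} (j : 'I_n) (f : Cn R n -> R[i]) (u : Cn R n) : R[i] :=
  2^-1 * (cD (delta_mx 0 j, 0) f u + 'i%C * cD (0, delta_mx 0 j) f u).

Definition holo {n m} (U : set (Cn R n)) (F : Cn R n -> Cn R m) : Prop :=
  forall a : 'I_m,
    csmooth U (fun u => zvec (F u) 0 a) /\
    forall u, U u -> forall j : 'I_n, dzb j (fun w => zvec (F w) 0 a) u = 0.

(** Row j holds the components of the derivative of F along d/dz_j, so tangent
    row vectors are pushed forward by right multiplication. *)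
Definition jac {n m} (F : Cn R n -> Cn R m) (u : Cn R n) : 'M[R[i]]_(n, m) :=
  \matrix_(j, a) dz j (fun w => zvec (F w) 0 a) u.

Definition ddbar {n} (f : Cn R n -> R) (u : Cn R n) : 'M[R[i]]_n :=
  \matrix_(j, k) dz j (dzb k (fun w => (f w)%:C)) u.

Definition is_hermitian {n} (A : 'M[R[i]]_n) : Prop := A^t* = A.

(** xi A (conj xi)^T = sum_jk A_jk xi_j conj(xi_k), which is real for A
    Hermitian; [complex.Re] only changes the type. *)
Definition hnorm2 {n} (A : 'M[R[i]]_n) (xi : 'rV[R[i]]_n) : R :=
  complex.Re ((xi *m A *m xi^t*) 0 0).

Definition posdef {n} (A : 'M[R[i]]_n) : Prop :=
  is_hermitian A /\ forall xi, xi != 0 -> 0 < hnorm2 A xi.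

(** Curvature of the matrix [G w j k] = g_(j, bar k).  The inverse coefficients
    satisfy sum_c g^(a, bar c) g_(b, bar c) = delta_ab, that is
    g^(a, bar c) = (invmx G) c a. *)
Definition curvature {n} (G : Cn R n -> 'M[R[i]]_n) (u : Cn R n)
    (j k l m : 'I_n) : R[i] :=
  - dz j (dzb k (fun w => G w l m)) u
  + \sum_a \sum_c invmx (G u) c a * dz j (fun w => G w l c) u
                                  * dzb k (fun w => G w a m) u.

Definition curvature4 {n} (G : Cn R n -> 'M[R[i]]_n) (u : Cn R n)
    (al be ga de : 'rV[R[i]]_n) : R[i] :=
  \sum_j \sum_k \sum_l \sum_m
    curvature G u j k l m * al 0 j * (be 0 k)^* * ga 0 l * (de 0 m)^*.

(** The numerator is real for G Hermitian and smooth. *)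
Definition hol_sec_coord {n} (G : Cn R n -> 'M[R[i]]_n) (u : Cn R n)
    (xi : 'rV[R[i]]_n) : R :=
  complex.Re (curvature4 G u xi xi xi xi) / hnorm2 (G u) xi ^+ 2.

End Calculus.

(** * Complex manifolds *)

Record chart (R : realType) (n : nat) (X : Type) := Chart {
  cdom : set X ;
  cmap : X -> Cn R n ;   (* relevant on cdom only *)
  cinv : Cn R n -> X     (* relevant on the image of cdom only *)
}.

Definition cimg R n X (c : @chart R n X) : set (Cn R n) := cmap c @` cdom c.

Definition is_chart R n (X : topologicalType) (c : chart R n X) : Prop :=
  [/\ open (cdom c), open (cimg c),
      forall x, cdom c x -> cinv c (cmap c x) = x,
      forall x, cdom c x -> {for x, continuous (cmap c)} &
      forall u, cimg c u -> {for u, continuous (cinv c)}].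

Definition holo_transition R n X (c d : chart R n X) : Prop :=
  holo (cmap c @` (cdom c `&` cdom d)) (cmap d \o cinv c).

(** The atlas is presented as a family indexed by the points, [chart_at x] being
    a chart around x. *)
Record cmanifold (R : realType) (n : nat) := CManifold {
  cm_space :> topologicalType ;
  cm_hausdorff : hausdorff_space cm_space ;
  cm_second_countable : @second_countable cm_space ;
  chart_at : cm_space -> chart R n cm_space ;
  chart_atP : forall x, is_chart (chart_at x) ;
  mem_chart_at : forall x, cdom (chart_at x) x ;
  chart_at_holo : forall x y, holo_transition (chart_at x) (chart_at y)
}.

Arguments chart_at {R n c} x : rename.

Section Manifolds.
Context {R : realType}.
Implicit Types n m : nat.

(** Any chart of the maximal atlas. *)
Definition holo_chart {n} (X : cmanifold R n) (c : chart R n X) : Prop :=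
  is_chart c /\
  forall x : X, holo_transition c (chart_at x) /\ holo_transition (chart_at x) c.

(** Holomorphy on an open set A, with values in a manifold or in C^m. *)
Definition holo_map {n m} (X : cmanifold R n) (Y : cmanifold R m)
    (A : set X) (F : X -> Y) : Prop :=
  (forall x, A x -> {for x, continuous F}) /\
  forall (x : X) (y : Y),
    holo (cmap (chart_at x) @`
            (A `&` cdom (chart_at x) `&` F @^-1` cdom (chart_at y)))
         (cmap (chart_at y) \o F \o cinv (chart_at x)).

Definition holo_fun {n m} (X : cmanifold R n) (A : set X) (F : X -> Cn R m)
    : Prop :=
  forall x : X, holo (cmap (chart_at x) @` (A `&` cdom (chart_at x)))
                     (F \o cinv (chart_at x)).

(** The holomorphic tangent space at x is 'rV[R[i]]_n, by means of the frame
    d/dz_1, ..., d/dz_n of [chart_at x]; accordingly, a field of sesquilinear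
    forms is a matrix g(d/dz_j, conj d/dz_k) at each point.  [form_coef] is the
    matrix of coefficients in an arbitrary chart. *)
Definition hform {n} (X : cmanifold R n) := X -> 'M[R[i]]_n.

Definition form_coef {n} (X : cmanifold R n) (g : hform X) (c : chart R n X)
    (u : Cn R n) : 'M[R[i]]_n :=
  let x := cinv c u in
  let J := jac (cmap (chart_at x) \o cinv c) u in
  J *m g x *m J^t*.

Definition smooth_form {n} (X : cmanifold R n) (g : hform X) : Prop :=
  forall (x : X) (j k : 'I_n),
    csmooth (cimg (chart_at x)) (fun u => form_coef g (chart_at x) u j k).

(** Closedness of (i/2) sum_jk g_(j, bar k) dz_j /\ d(conj z_k): vanishing of its
    (2,1) and (1,2) differentials. *)
Definition closed_form {n} (X : cmanifold R n) (g : hform X) : Prop :=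
  forall (x : X) (u : Cn R n), cimg (chart_at x) u -> forall j k l : 'I_n,
    let G := form_coef g (chart_at x) in
    dz l (fun w => G w j k) u = dz j (fun w => G w l k) u /\
    dzb l (fun w => G w j k) u = dzb k (fun w => G w j l) u.

(** Hermitian forms associated to closed real smooth (1,1)-forms. *)
Definition closed_real_form {n} (X : cmanifold R n) (g : hform X) : Prop :=
  [/\ forall x, is_hermitian (g x), smooth_form g & closed_form g].

Definition kahler {n} (X : cmanifold R n) (g : hform X) : Prop :=
  closed_real_form g /\ forall x, posdef (g x).

Definition hol_sec_curv {n} (X : cmanifold R n) (g : hform X) (x : X)
    (xi : 'rV[R[i]]_n) : R :=
  hol_sec_coord (form_coef g (chart_at x)) (cmap (chart_at x) x) xi.

Definition pullback {n m} (X : cmanifold R n) (Y : cmanifold R m) (F : X -> Y)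
    (g : hform Y) : hform X :=
  fun x => let J := jac (cmap (chart_at (F x)) \o F \o cinv (chart_at x))
                        (cmap (chart_at x) x) in
           J *m g (F x) *m J^t*.

Definition pullback_Cn {n m} (X : cmanifold R n) (F : X -> Cn R m)
    (G : Cn R m -> 'M[R[i]]_m) : hform X :=
  fun x => let J := jac (F \o cinv (chart_at x)) (cmap (chart_at x) x) in
           J *m G (F x) *m J^t*.

End Manifolds.

(** * The blowup of a point *)

(** P(C^n), as the set of lines of C^n. *)
Definition projsp (R : realType) (n : nat) :=
  {l : {vspace 'rV[R[i]]_n} | \dim l == 1%N}.

Section Blowup.
Context {R : realType} {n : nat}.
Implicit Types X Xh : cmanifold R n.

(** The incidence manifold {(v, l) | v \in l} in C^n * P(C^n) has the standard
    coordinates y on the open set of the (v, l) with l not in {w_i = 0}: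
    l is spanned by w = (y_1, ..., 1, ..., y_n) (1 in position i), and v = y_i w. *)
Definition aff_gen (i : 'I_n) (y : 'rV[R[i]]_n) : 'rV[R[i]]_n :=
  \row_j (if j == i then 1 else y 0 j).

(** [x |-> (phi (mu x), L x)] identifies mu^-1(cdom phi) biholomorphically with
    the part of the incidence manifold lying over the image of phi: it is a
    bijection that turns the standard coordinates into holomorphic charts. *)
Definition blowup_over X Xh (mu : Xh -> X) (phi : chart R n X)
    (L : Xh -> projsp R n) : Prop :=
  set_bij [set x | cdom phi (mu x)]
          [set a : Cn R n * projsp R n | cimg phi a.1 /\ zvec a.1 \in sval a.2]
          (fun x => (cmap phi (mu x), L x)) /\
  forall i : 'I_n, exists c : chart R n Xh,
    [/\ holo_chart c,
        cdom c = [set x | cdom phi (mu x) /\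
                          exists2 w, w \in sval (L x) & w 0 i != 0] &
        forall x, cdom c x ->
          let y := zvec (cmap c x) in
          zvec (cmap phi (mu x)) = y 0 i *: aff_gen i y /\
          sval (L x) = <[aff_gen i y]>%VS].

Definition centered_chart X (p : X) (phi : chart R n X) : Prop :=
  [/\ holo_chart phi, cdom phi p & cmap phi p = 0].

Definition is_blowup X Xh (p : X) (mu : Xh -> X) : Prop :=
  [/\ holo_map setT mu,
      exists nu : X -> Xh,
        [/\ holo_map (~` [set p]) nu,
            forall x, x <> p -> mu (nu x) = x &
            forall y, mu y <> p -> nu (mu y) = y] &
      exists (phi : chart R n X) (L : Xh -> projsp R n),
        centered_chart p phi /\ blowup_over mu phi L].

Definition exc_divisor X Xh (p : X) (mu : Xh -> X) : set Xh := mu @^-1` [set p].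

(** ** The form b *)

Section FormB.
(** Q is the Gram matrix of the inner product on C^n. *)
Context (Q : 'M[R[i]]_n).

Definition Qball (r : R) : set (Cn R n) :=
  [set u | hnorm2 Q (zvec u) < r ^+ 2].

Definition log_norm2 (u : Cn R n) : R := ln (hnorm2 Q (zvec u)).

Definition is_bump (phi : set (Cn R n)) (r : R) (chi : Cn R n -> R) : Prop :=
  [/\ smooth setT chi,
      compact (closure [set u | chi u != 0]),
      closure [set u | chi u != 0] `<=` phi &
      forall u, Qball r u -> chi u = 1].

(** On the part of Xh where L is defined, the pullback by L of the Fubini-Study
    form is s^*(ddbar log |v|^2) for every local holomorphic lift s of L to
    C^n \ {0}: this is what it means that ddbar log |v|^2 descends to P(C^n). *)
Definition FS_pullback_on Xh (L : Xh -> projsp R n) (A : set Xh) (b : hform Xh)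
    : Prop :=
  forall (B : set Xh) (s : Xh -> Cn R n), open B -> B `<=` A -> holo_fun B s ->
    (forall x, B x -> zvec (s x) != 0 /\ sval (L x) = <[zvec (s x)]>%VS) ->
    forall x, B x -> b x = pullback_Cn s (ddbar log_norm2) x.

(** b = ddbar (chi log |v|^2), extended across the exceptional divisor by the
    pullback of the Fubini-Study form, and by 0 outside the chart. *)
Definition is_form_b X Xh (p : X) (mu : Xh -> X) (phi : chart R n X)
    (L : Xh -> projsp R n) (r : R) (chi : Cn R n -> R) (b : hform Xh) : Prop :=
  [/\ closed_real_form b,
      FS_pullback_on L
        [set x | cdom phi (mu x) /\ Qball r (cmap phi (mu x))] b,
      forall x, cdom phi (mu x) -> mu x <> p ->
        b x = pullback_Cn (cmap phi \o mu)
                (ddbar (fun u => chi u * log_norm2 u)) x &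
      forall x, ~ cdom phi (mu x) -> b x = 0].

End FormB.

Definition h_t X Xh (mu : Xh -> X) (h : hform X) (b : hform Xh) (t : R) : hform Xh :=
  fun x => pullback mu h x + t%:C *: b x.

End Blowup.

(* Main.v *)
Require Import Defs.
From mathcomp Require Import ring lra.

(** The blowdown has a chart y around q in which it reads v = y_i w, where the
    vector w = (y_1, ..., 1, ..., y_n) spans the line parametrized by y and y_i = 0
    is the exceptional divisor E.  Along E, the form mu^*h degenerates to the rank
    one form |dy_i|^2 |w|_h^2, whereas b is the Fubini-Study form pulled back by
    w: it is positive on the tangent vectors of E and has the kernel dw = 0.
    Choose e in this kernel with dy_i(e) = 1, choose x tangent to E with
    f = dw(x) not proportional to w, and put xi = s e + x for a small s > 0.

    The curvature of G in the direction xi is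
      - xi (DDb G) xi^* + |xi (D G)|^2,
    where D, Db differentiate along xi and its conjugate and the norm is that of
    the inverse of G.

    Contribution of mu^*h.  Let eta = dmu(xi), so that eta = s w at q.  The Leibniz
    rule for v = y_i w gives D eta = c w + 2 s f + O(s^2): the same term y_i w
    contributes f once through dy_i(xi) = s and once more through the
    derivative of w.  The first summand of the curvature is thus
    - |D eta|^2 + O(s^3), up to terms that complete the square, and the part
    O(s^4) which is the curvature of h itself.  The second summand can only
    restore the component of D eta along w, because mu^*h has rank one at q.  What
    is left is - |2 s f'|^2 + O(s^3), with f' the nonzero component of f orthogonal
    to w.  It is negative for small s ([degenerate_curvature_lt0]).

    Contribution of t b.  The inverse of h_t has size 1/t in the directions of E,
    but it is applied to xi (D h_t) = z dy_i^* + t beta with beta vanishing on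
    the kernel e of b, so this only adds t times a number independent of t
    ([degenerate_inverse_norm]).  Hence s is fixed first and t0 is chosen afterwards
    ([blowup_chart_negative]).

    The computation is carried out directly in the preferred chart of the blowup
    at q, with y and the blowdown as holomorphic maps of these coordinates.  The
    form h is then a matrix function composed with a holomorphic map, multiplied by
    the Jacobian and its adjoint; the product rule is used in the form
    [DDb_sandwich], which requires that derivatives of holomorphic functions are
    holomorphic and hence the symmetry of second derivatives [derive_comm]. *)

Set Implicit Arguments.
Unset Strict Implicit.
Unset Printing Implicit Defensive.

Import Order.TTheory GRing.Theory Num.Theory.
Import numFieldNormedType.Exports.

Local Open Scope classical_set_scope.
Local Open Scope complex_scope.
Local Open Scope ring_scope.

(** * Symmetry of second derivatives *)

Section Schwarz.
Context {R : realType} {V : normedModType R}.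

Lemma differentiable_approx (g : V -> R) u : differentiable g u -> forall e : R, 0 < e ->
  \forall h \near (0 : V), `|g (h + u) - g u - 'd g u h| <= e * `|h|.
Proof.
move=> dg e e0.
have H := (eqaddoP _ _ _ _).1 (diff_locally dg).
by move: (H _ e0); apply: filterS => h /=; rewrite !fctE opprD addrA.
Qed.

Lemma is_derive_line (f : V -> R) (a v : V) (s : R) :
  differentiable f (a + s *: v) ->
  is_derive s 1 (fun s => f (a + s *: v)) ('D_v f (a + s *: v)).
Proof.
move=> df.
have dl : is_diff s (fun s : R => a + s *: v) (fun h => h *: v).
  have -> : (fun h : R => h *: v) = 0 + (fun h : R => h *: v).
    by apply/funext => h; rewrite !fctE add0r.
  exact: (@is_diffD _ _ _ (cst a) (fun s : R => s *: v) 0 (fun s : R => s *: v) s).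
have dl' : differentiable (fun s : R => a + s *: v) s by apply: ex_diff.
have dc := differentiable_comp dl' df.
apply: DeriveDef; first exact: diff_derivable.
rewrite deriveE// diff_comp//=.
by rewrite diff_val scale1r deriveE.
Qed.

(** The mean value theorem applied to s |-> f (u + s v + h w) - f (u + s v) turns
    the second difference into h times a difference of values of D_v f, which the
    differentiability of D_v f at u estimates. *)
Lemma second_difference_approx (f : V -> R) (u v w : V) :
  (\forall x \near u, differentiable f x) ->
  differentiable (fun x => 'D_v f x) u ->
  forall e : R, 0 < e -> \forall h \near (0:R)^'+,
   `|(f (u + h *: v + h *: w) - f (u + h *: v) - f (u + h *: w) + f u) 
      - h ^+ 2 * 'D_w (fun x => 'D_v f x) u| <= e * h ^+ 2.
Proof.
move=> nf dDv e e0.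
(* The factor 2 leaves room for the two error terms; 1 makes K positive. *)
pose K := (`|v| + `|w| + 1) *+ 2 .
have K0 : 0 < K by rewrite /K pmulrn_lgt0// ltr_wpDl// addr_ge0.
have eK : 0 < e / K by rewrite divr_gt0.
have /nbhs_ballP[d /= d0 Hd] := differentiable_approx dDv eK.
have /nbhs_ballP[d' /= d'0 Hd'] := nf.
near=> h.
have h0 : 0 < h by near: h; exact: nbhs_right_gt.
have small s t : 0 <= s -> s <= h -> 0 <= t -> t <= h ->
    `|s *: v + t *: w| <= h * (`|v| + `|w|).
  move=> s0 sh t0 th; apply: (le_trans (ler_normD _ _)).
  by rewrite !normrZ !ger0_norm// mulrDr lerD// ler_wpM2r.
have hd : h * (`|v| + `|w|) < d.
  have : h < d / K by near: h; apply: nbhs_right_lt; rewrite divr_gt0.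
  rewrite ltr_pdivlMr//; apply: le_lt_trans; rewrite ler_pM2l//.
  rewrite /K mulr2n; have := normr_ge0 v; have := normr_ge0 w; lra.
have hd' : h * (`|v| + `|w|) < d'.
  have : h < d' / K by near: h; apply: nbhs_right_lt; rewrite divr_gt0.
  rewrite ltr_pdivlMr//; apply: le_lt_trans; rewrite ler_pM2l//.
  rewrite /K mulr2n; have := normr_ge0 v; have := normr_ge0 w; lra.
have df s t : 0 <= s -> s <= h -> 0 <= t -> t <= h ->
    differentiable f (u + (s *: v + t *: w)).
  move=> s0 sh t0 th; apply: Hd' => /=.
  by rewrite -ball_normE/= opprD addrA subrr add0r normrN (le_lt_trans (small s t _ _ _ _)).
have hE t : u + t *: w = u + (0 *: v + t *: w) by rewrite scale0r add0r.
pose ph s := f ((u + h *: w) + s *: v) - f (u + s *: v).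
have dph s : s \in `[0, h] -> is_derive s 1 ph
     ('D_v f ((u + h *: w) + s *: v) - 'D_v f (u + s *: v)).
  rewrite in_itv/= => /andP[s0 sh].
  apply: is_deriveB; apply: is_derive_line.
    by rewrite -addrA [h *: w + _]addrC; apply: df => //; exact: ltW.
  by have := df s 0 s0 sh; rewrite scale0r addr0; apply=> //; exact: ltW.
have [|th thh] := MVT h0 (fun s sh => dph s (subset_itv_oo_cc sh)).
  by apply: derivable_within_continuous => s /dph [].
rewrite subr0.
have -> : ph h - ph 0 = f (u + h *: v + h *: w) - f (u + h *: v) - f (u + h *: w) + f u.
  rewrite /ph !scale0r !addr0 (addrAC u (h *: w)); ring.
move=> ->.
have /andP[th0 thh'] : 0 <= th <= h.
  by move: thh; rewrite in_itv/= => /andP[/ltW -> /ltW ->].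
have nd t : 0 <= t -> t <= h -> ball (0 : V) d (th *: v + t *: w).
  by move=> t0 tn; rewrite -ball_normE/= sub0r normrN (le_lt_trans (small th t _ _ _ _)).
have H1 := Hd _ (nd h (ltW h0) (lexx _)).
have H2 := Hd _ (nd 0 (lexx _) (ltW h0)).
have B1 := small th h th0 thh' (ltW h0) (lexx _).
have B2 := small th 0 th0 thh' (lexx _) (ltW h0).
set T1 := 'D_v f (u + h *: w + th *: v); set T2 := 'D_v f (u + th *: v).
have E1 : 'D_v f (th *: v + h *: w + u) = T1 by rewrite /T1 addrC addrA addrAC.
have E2 : 'D_v f (th *: v + 0 *: w + u) = T2 by rewrite /T2 scale0r addr0 addrC.
rewrite E1 in H1; rewrite E2 in H2.
rewrite deriveE//.
set L := 'd _ u in H1 H2 *.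
have LE : L (th *: v + h *: w) = L (th *: v + 0 *: w) + h * L w.
  by rewrite !linearD !linearZ/= scale0r addr0.
have N1 := ler_wpM2l (ltW eK) B1.
have N2 := ler_wpM2l (ltW eK) B2.
have -> : (T1 - T2) * h - h ^+ 2 * L w =
  h * ((T1 - 'D_v f u - L (th *: v + h *: w)) -
       (T2 - 'D_v f u - L (th *: v + 0 *: w))).
  rewrite LE; ring.
rewrite normrM (gtr0_norm h0) [e * _]mulrC expr2 -mulrA ler_pM2l//.
apply: (le_trans (ler_normB _ _)).
apply: (le_trans (lerD (le_trans H1 N1) (le_trans H2 N2))).
have eh : h * e = e / K * (h * K) by rewrite mulrCA divfK ?gt_eqF //.
rewrite eh.
rewrite -mulrDr ler_pM2l// -mulrDr ler_pM2l// /K mulr2n.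
lra.
Unshelve. all: by end_near. Qed.

(** The second difference is symmetric in v and w, so both iterated derivatives
    are its limit after division by h^2. *)
Lemma derive_comm (f : V -> R) (u v w : V) :
  (\forall x \near u, differentiable f x) ->
  differentiable (fun x => 'D_v f x) u ->
  differentiable (fun x => 'D_w f x) u ->
  'D_w (fun x => 'D_v f x) u = 'D_v (fun x => 'D_w f x) u.
Proof.
move=> nf dv dw; apply/eqP; rewrite -subr_eq0 -normr_le0.
apply/ler_addgt0Pr => e e0; rewrite add0r.
have e20 : 0 < e / 2 by rewrite divr_gt0.
have A1 := @second_difference_approx f u v w nf dv _ e20.
have A2 := @second_difference_approx f u w v nf dw _ e20.
have [h /= [h0 [H1 H2]]] :=
  filter_ex (filterI (nbhs_right_gt (0 : R)) (filterI A1 A2)).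
have h20 : 0 < h ^+ 2 by rewrite exprn_gt0.
rewrite -(ler_pM2l h20) -{1}(gtr0_norm h20) -normrM.
have EE : u + h *: w + h *: v = u + h *: v + h *: w by rewrite addrAC.
rewrite EE in H2.
move: H1 H2; move: (f (u + h *: v + h *: w)) (f (u + h *: v)) (f (u + h *: w)) (f u) => T a b c.
move: ('D_w _ u) ('D_v _ u) => D1 D2 H1 H2.
have -> : h ^+ 2 * (D1 - D2) = ((T - b - a + c) - h ^+ 2 * D2) -
  ((T - a - b + c) - h ^+ 2 * D1) by ring.
apply: (le_trans (ler_normB _ _)).
apply: (le_trans (lerD H2 H1)); lra.
Qed.

End Schwarz.

(** * Wirtinger operators at a point *)

Section NearDiff.
Context {R : realType} {V W : normedModType R}.

(** The differential is a choice made from the function, so that changing the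
    function away from u requires going back to the first-order expansion. *)
Lemma near_differentiable (f g : V -> W) u :
  (\near u, f u = g u) -> differentiable f u -> differentiable g u.
Proof.
move=> fg df.
have H : g \o shift u = cst (g u) + 'd f u +o_ 0 id.
  apply/eqaddoP => e e0.
  have := (eqaddoP _ _ _ _).1 (diff_locally df) e e0.
  have : \forall h \near (0:V), f (h + u) = g (h + u).
    by move: fg; rewrite (near_shift 0); apply: filterS => h /=; rewrite subr0.
  apply: filterS2 => h /= E; rewrite !fctE /= E.
  by rewrite (nbhs_singleton fg).
have dE := diff_unique (diff_continuous df) H.
by apply/diff_locallyP; rewrite dE; split=> //; exact: diff_continuous.
Qed.
End NearDiff.

Section ReIm.
Context {R : realType}.
Implicit Types x y : R[i].
Lemma cReD x y : complex.Re (x + y) = complex.Re x + complex.Re y.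
Proof. by case: x y => [? ?] []. Qed.
Lemma cImD x y : complex.Im (x + y) = complex.Im x + complex.Im y.
Proof. by case: x y => [? ?] []. Qed.
Lemma cReM x y : complex.Re (x * y) = complex.Re x * complex.Re y - complex.Im x * complex.Im y.
Proof. by case: x y => [? ?] []. Qed.
Lemma cImM x y : complex.Im (x * y) = complex.Re x * complex.Im y + complex.Im x * complex.Re y.
Proof. by case: x y => [? ?] []. Qed.
Lemma cReJ x : complex.Re (Num.conj x) = complex.Re x.
Proof. by case: x. Qed.
Lemma cImJ x : complex.Im (Num.conj x) = - complex.Im x.
Proof. by case: x. Qed.
Lemma cReMr (r : R) x : complex.Re (r%:C * x) = r * complex.Re x.
Proof. by case: x => a b /=; rewrite mul0r subr0. Qed.
Lemma cImMr (r : R) x : complex.Im (r%:C * x) = r * complex.Im x.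
Proof. by case: x => a b /=; rewrite mul0r addr0. Qed.
Lemma complex_ext x y : complex.Re x = complex.Re y -> complex.Im x = complex.Im y -> x = y.
Proof. by case: x y => [? ?] [? ?] /= -> ->. Qed.
End ReIm.

Section CDiff.
Context {R : realType} {n : nat}.
Implicit Types (f g : Cn R n -> R[i]) (u v : Cn R n) (j : 'I_n).

(** R[i] carries no normed structure over R here, so real differentiability is
    asked of the two components. *)
Definition cdiff f u : Prop :=
  differentiable (fun w => complex.Re (f w)) u /\
  differentiable (fun w => complex.Im (f w)) u.

Lemma cdiff_near f g u : (\near u, f u = g u) -> cdiff f u -> cdiff g u.
Proof.
move=> fg [a b]; split.
  by apply: near_differentiable a; apply: filterS fg => w ->.
by apply: near_differentiable b; apply: filterS fg => w ->.
Qed.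

Lemma cD_near f g u v : (\near u, f u = g u) -> cD v f u = cD v g u.
Proof.
move=> fg; congr (_ +i* _); apply: near_eq_derive; apply: filterS fg => w -> //.
Qed.

Lemma cdiffD f g u : cdiff f u -> cdiff g u -> cdiff (fun w => f w + g w) u.
Proof.
move=> [a b] [c d]; split.
  by under eq_fun do rewrite cReD; exact: differentiableD.
by under eq_fun do rewrite cImD; exact: differentiableD.
Qed.

Lemma cDD f g u v : cdiff f u -> cdiff g u ->
  cD v (fun w => f w + g w) u = cD v f u + cD v g u.
Proof.
move=> [/diff_derivable a /diff_derivable b] [/diff_derivable c /diff_derivable d].
apply: complex_ext; rewrite ?cReD ?cImD /cD /=.
  under eq_fun do rewrite cReD.
  by rewrite (deriveD (a v) (c v)).
under eq_fun do rewrite cImD.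
by rewrite (deriveD (b v) (d v)).
Qed.

Lemma cdiffM f g u : cdiff f u -> cdiff g u -> cdiff (fun w => f w * g w) u.
Proof.
move=> [a b] [c d]; split.
  under eq_fun do rewrite cReM; apply: differentiableB; exact: differentiableM.
by under eq_fun do rewrite cImM; apply: differentiableD; exact: differentiableM.
Qed.

Lemma cDM f g u v : cdiff f u -> cdiff g u ->
  cD v (fun w => f w * g w) u = cD v f u * g u + f u * cD v g u.
Proof.
move=> [/diff_derivable a /diff_derivable b] [/diff_derivable c /diff_derivable d].
apply: complex_ext; rewrite ?cReD ?cImD ?cReM ?cImM /cD /=.
  under eq_fun do rewrite cReM.
  rewrite (deriveB (derivableM (a v) (c v)) (derivableM (b v) (d v))).
  rewrite (deriveM (a v) (c v)) (deriveM (b v) (d v)).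
  rewrite /GRing.scale /=.
  move: ('D_v _ u) ('D_v _ u) ('D_v _ u) ('D_v _ u) => *; ring.
under eq_fun do rewrite cImM.
rewrite (deriveD (derivableM (a v) (d v)) (derivableM (b v) (c v))).
rewrite (deriveM (a v) (d v)) (deriveM (b v) (c v)).
rewrite /GRing.scale /=.
move: ('D_v _ u) ('D_v _ u) ('D_v _ u) ('D_v _ u) => *; ring.
Qed.

Lemma cdiff_conj f u : cdiff f u -> cdiff (fun w => Num.conj (f w)) u.
Proof.
move=> [a b]; split; first by under eq_fun do rewrite cReJ.
by under eq_fun do rewrite cImJ; exact: differentiableN.
Qed.

Lemma cD_conj f u v : cdiff f u ->
  cD v (fun w => Num.conj (f w)) u = Num.conj (cD v f u).
Proof.
move=> [a b]; apply: complex_ext; rewrite ?cReJ ?cImJ /cD /=.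
  by under eq_fun do rewrite cReJ.
by under eq_fun do rewrite cImJ; rewrite deriveN//; exact: diff_derivable.
Qed.

Lemma cdiff_cst (c : R[i]) u : cdiff (fun=> c) u.
Proof. by split; exact: differentiable_cst. Qed.

Lemma cD_cst (c : R[i]) u v : cD v (fun=> c) u = 0.
Proof. by rewrite /cD !derive_cst. Qed.

Lemma cdiff_sum I (r : seq I) (F : I -> Cn R n -> R[i]) u :
  (forall i, cdiff (F i) u) -> cdiff (fun w => \sum_(i <- r) F i w) u.
Proof.
move=> dF; elim: r => [|i r IH].
  by under eq_fun do rewrite big_nil; exact: cdiff_cst.
by under eq_fun do rewrite big_cons; exact: cdiffD.
Qed.

Lemma cD_sum I (r : seq I) (F : I -> Cn R n -> R[i]) u v :
  (forall i, cdiff (F i) u) ->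
  cD v (fun w => \sum_(i <- r) F i w) u = \sum_(i <- r) cD v (F i) u.
Proof.
move=> dF; elim: r => [|i r IH].
  by under eq_fun do rewrite big_nil; rewrite big_nil cD_cst.
under eq_fun do rewrite big_cons.
by rewrite big_cons -IH cDD//; exact: cdiff_sum.
Qed.

Lemma dz_near j f g u : (\near u, f u = g u) -> dz j f u = dz j g u.
Proof. by move=> fg; rewrite /dz !(cD_near _ fg). Qed.
Lemma dzb_near j f g u : (\near u, f u = g u) -> dzb j f u = dzb j g u.
Proof. by move=> fg; rewrite /dzb !(cD_near _ fg). Qed.

Lemma dzD j f g u : cdiff f u -> cdiff g u ->
  dz j (fun w => f w + g w) u = dz j f u + dz j g u.
Proof.
move=> df dg; rewrite /dz !cDD//.
by rewrite -mulrDr; congr (_ * _); rewrite mulrDr opprD addrACA.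
Qed.
Lemma dzbD j f g u : cdiff f u -> cdiff g u ->
  dzb j (fun w => f w + g w) u = dzb j f u + dzb j g u.
Proof.
move=> df dg; rewrite /dzb !cDD//.
by rewrite -mulrDr; congr (_ * _); rewrite mulrDr addrACA.
Qed.

Lemma dzM j f g u : cdiff f u -> cdiff g u ->
  dz j (fun w => f w * g w) u = dz j f u * g u + f u * dz j g u.
Proof.
move=> df dg; rewrite /dz !cDM//.
move: (cD _ f u) (cD _ f u) (cD _ g u) (cD _ g u) 'i%C 2^-1 => *; ring.
Qed.
Lemma dzbM j f g u : cdiff f u -> cdiff g u ->
  dzb j (fun w => f w * g w) u = dzb j f u * g u + f u * dzb j g u.
Proof.
move=> df dg; rewrite /dzb !cDM//.
move: (cD _ f u) (cD _ f u) (cD _ g u) (cD _ g u) 'i%C 2^-1 => *; ring.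
Qed.

Lemma conj_2V : Num.conj (2^-1 : R[i]) = 2^-1.
Proof. by rewrite fmorphV rmorph_nat. Qed.

Lemma conj_i : Num.conj ('i%C : R[i]) = - 'i%C.
Proof. by rewrite -[Num.conj _]/(conjc _); apply: complex_ext => /=; rewrite ?oppr0. Qed.

Lemma dz_conj j f u : cdiff f u ->
  dz j (fun w => Num.conj (f w)) u = Num.conj (dzb j f u).
Proof.
move=> df; rewrite /dz /dzb !cD_conj// rmorphM rmorphD rmorphM /= conj_2V conj_i.
by rewrite mulNr.
Qed.
Lemma dzb_conj j f u : cdiff f u ->
  dzb j (fun w => Num.conj (f w)) u = Num.conj (dz j f u).
Proof.
move=> df; rewrite /dz /dzb !cD_conj// rmorphM rmorphB rmorphM /= conj_2V conj_i.
by rewrite mulNr opprK.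
Qed.

Lemma dz_cst j (c : R[i]) u : dz j (fun=> c) u = 0.
Proof. by rewrite /dz !cD_cst mulr0 subrr mulr0. Qed.
Lemma dzb_cst j (c : R[i]) u : dzb j (fun=> c) u = 0.
Proof. by rewrite /dzb !cD_cst mulr0 addr0 mulr0. Qed.

Lemma dz_sum j I (r : seq I) (F : I -> Cn R n -> R[i]) u :
  (forall i, cdiff (F i) u) ->
  dz j (fun w => \sum_(i <- r) F i w) u = \sum_(i <- r) dz j (F i) u.
Proof.
by move=> dF; rewrite /dz !cD_sum// mulr_sumr -sumrB mulr_sumr.
Qed.
Lemma dzb_sum j I (r : seq I) (F : I -> Cn R n -> R[i]) u :
  (forall i, cdiff (F i) u) ->
  dzb j (fun w => \sum_(i <- r) F i w) u = \sum_(i <- r) dzb j (F i) u.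
Proof.
by move=> dF; rewrite /dzb !cD_sum// mulr_sumr -big_split/= mulr_sumr.
Qed.

Lemma cn_decomp v :
  v = \sum_(a < n) (v.1 0 a *: ((delta_mx 0 a, 0) : Cn R n)
    + v.2 0 a *: ((0, delta_mx 0 a) : Cn R n)).
Proof.
rewrite big_split /=; case: v => x y /=; congr pair.
  transitivity (\sum_(a < n) x 0 a *: delta_mx 0 a : 'rV[R]_n); first exact: row_sum_delta.
  rewrite (raddf_sum (@fst 'rV[R]_n 'rV[R]_n)) (raddf_sum (@fst 'rV[R]_n 'rV[R]_n)) /=.
  by rewrite [X in _ = _ + X]big1 ?addr0// => a _; rewrite scaler0.
transitivity (\sum_(a < n) y 0 a *: delta_mx 0 a : 'rV[R]_n); first exact: row_sum_delta.
rewrite (raddf_sum (@snd 'rV[R]_n 'rV[R]_n)) (raddf_sum (@snd 'rV[R]_n 'rV[R]_n)) /=.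
by rewrite [X in _ = X + _]big1 ?add0r// => a _; rewrite scaler0.
Qed.

Lemma derive_decomp (f : Cn R n -> R) u v : differentiable f u ->
  'D_v f u = \sum_(a < n) (v.1 0 a * 'D_(delta_mx 0 a, 0) f u + v.2 0 a * 'D_(0, delta_mx 0 a) f u).
Proof.
move=> df; rewrite deriveE// {1}(cn_decomp v) linear_sum; apply: eq_bigr => a _.
by rewrite linearD !linearZ /= !deriveE.
Qed.

Lemma sum_re_im (x y a1 a2 b1 b2 : 'I_n -> R) :
  (\sum_c (x c * a1 c + y c * a2 c)) +i* (\sum_c (x c * b1 c + y c * b2 c)) =
  \sum_c ((x c)%:C * (a1 c +i* b1 c) + (y c)%:C * (a2 c +i* b2 c)).
Proof.
apply: complex_ext => /=.
  rewrite (big_morph _ cReD (erefl : complex.Re (0 : R[i]) = 0)).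
  by apply: eq_bigr => c _; rewrite cReD !cReMr.
rewrite (big_morph _ cImD (erefl : complex.Im (0 : R[i]) = 0)).
by apply: eq_bigr => c _; rewrite cImD !cImMr.
Qed.

(** A real differential is the sum of its C-linear and C-antilinear parts; the
    chain rule for the Wirtinger operators is a consequence. *)
Lemma cDE f u v : cdiff f u ->
  cD v f u = \sum_(a < n) (dz a f u * zvec v 0 a + dzb a f u * Num.conj (zvec v 0 a)).
Proof.
move=> [a b].
have -> : cD v f u = \sum_(a < n)
    ((v.1 0 a)%:C * cD (delta_mx 0 a, 0) f u + (v.2 0 a)%:C * cD (0, delta_mx 0 a) f u).
  rewrite /cD derive_decomp// (derive_decomp _ b).
  exact: sum_re_im.
apply: eq_bigr => c _.
rewrite /dz /dzb /zvec mxE.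
move: (cD (delta_mx 0 c, 0) f u) (cD (0, delta_mx 0 c) f u) (v.1 0 c) (v.2 0 c) => A B x y.
rewrite [x +i* y]complexE /= rmorphD rmorphM /= conj_i.
have -> : Num.conj (x%:C) = x%:C by rewrite -[Num.conj _]/(conjc _) /= oppr0.
have -> : Num.conj (y%:C) = y%:C by rewrite -[Num.conj _]/(conjc _) /= oppr0.
have i2 : 'i%C * 'i%C = -1 :> R[i] by rewrite -expr2 sqr_i.
have t2 : (2 : R[i]) != 0 by rewrite pnatr_eq0.
apply: (mulfI t2).
set I := 'i%C in i2 *.
have -> : 2 * (2^-1 * (A - I * B) * (x%:C + I * y%:C) + 2^-1 * (A + I * B) * (x%:C + - I * y%:C))
   = (2 * 2^-1) * (2 * (A * x%:C - (I * I) * B * y%:C)) by ring.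
rewrite i2 mulfV// mul1r mulN1r mulNr opprK. ring.
Qed.

End CDiff.

(** * Chain rule, smooth and holomorphic functions *)

Lemma derive_scalel (R : realType) (V W : normedModType R) (k : V -> R) (f : W) u v :
  differentiable k u -> 'D_v (fun z => k z *: f) u = 'D_v k u *: f.
Proof.
move=> dk; rewrite (deriveE v (differentiableZl f dk)) (diffZl f dk) (deriveE v dk).
by [].
Qed.

Section WirtAlg.
Context {R : realType}.
Lemma dz_alg (p q x y : R[i]) :
  2^-1 * (p * x + q * Num.conj x - 'i%C * (p * y + q * Num.conj y)) =
  p * (2^-1 * (x - 'i%C * y)) + q * Num.conj (2^-1 * (x + 'i%C * y)).
Proof.
rewrite rmorphM rmorphD rmorphM /= conj_2V conj_i.
move: (Num.conj x) (Num.conj y) 'i%C 2^-1 => *; ring.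
Qed.
Lemma dzb_alg (p q x y : R[i]) :
  2^-1 * (p * x + q * Num.conj x + 'i%C * (p * y + q * Num.conj y)) =
  p * (2^-1 * (x + 'i%C * y)) + q * Num.conj (2^-1 * (x - 'i%C * y)).
Proof.
rewrite rmorphM rmorphB rmorphM /= conj_2V conj_i.
move: (Num.conj x) (Num.conj y) 'i%C 2^-1 => *; ring.
Qed.
Lemma dzb_dz_alg (a b c d a' b' c' d' : R[i]) :
  a = a' -> b = b' -> c = c' -> d = d' ->
  2^-1 * (2^-1 * (a - 'i%C * b) + 'i%C * (2^-1 * (c - 'i%C * d))) =
  2^-1 * (2^-1 * (a' + 'i%C * c') - 'i%C * (2^-1 * (b' + 'i%C * d'))).
Proof. by move=> -> -> -> ->; move: 'i%C 2^-1 => *; ring. Qed.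
Lemma dz_dz_alg (a b c d a' b' c' d' : R[i]) :
  a = a' -> b = b' -> c = c' -> d = d' ->
  2^-1 * (2^-1 * (a - 'i%C * b) - 'i%C * (2^-1 * (c - 'i%C * d))) =
  2^-1 * (2^-1 * (a' - 'i%C * c') - 'i%C * (2^-1 * (b' - 'i%C * d'))).
Proof. by move=> -> -> -> ->; move: 'i%C 2^-1 => *; ring. Qed.
End WirtAlg.

Section Chain.
Context {R : realType} {n m : nat}.
Implicit Types (F : Cn R n -> Cn R m) (u v : Cn R n).

Definition vdiff F u := forall a, cdiff (fun w => zvec (F w) 0 a) u.

Lemma cn_decomp_map F w :
  F w = \sum_(a < m) (complex.Re (zvec (F w) 0 a) *: ((delta_mx 0 a, 0) : Cn R m)
    + complex.Im (zvec (F w) 0 a) *: ((0, delta_mx 0 a) : Cn R m)).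
Proof. by rewrite {1}(cn_decomp (F w)); apply: eq_bigr => a _; rewrite mxE. Qed.

Lemma vdiff_differentiable F u : vdiff F u -> differentiable F u.
Proof.
move=> dF.
have -> : F = \sum_(a < m) (fun w => complex.Re (zvec (F w) 0 a) *: ((delta_mx 0 a, 0) : Cn R m)
    + complex.Im (zvec (F w) 0 a) *: ((0, delta_mx 0 a) : Cn R m)).
  by apply/funext => w; rewrite fct_sumE {1}(cn_decomp_map F w).
apply: differentiable_sum => a; have [da db] := dF a.
by apply: differentiableD; exact: differentiableZl.
Qed.

Lemma zvec_derive F u v : vdiff F u ->
  zvec ('D_v F u) = \row_a cD v (fun w => zvec (F w) 0 a) u.
Proof.
move=> dF.
have -> : 'D_v F u = \sum_(a < m)
   ('D_v (fun w => complex.Re (zvec (F w) 0 a)) u *: ((delta_mx 0 a, 0) : Cn R m)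
    + 'D_v (fun w => complex.Im (zvec (F w) 0 a)) u *: ((0, delta_mx 0 a) : Cn R m)).
  have FE : F = \sum_(a < m) ((fun w => complex.Re (zvec (F w) 0 a) *: ((delta_mx 0 a, 0) : Cn R m))
    + (fun w => complex.Im (zvec (F w) 0 a) *: ((0, delta_mx 0 a) : Cn R m))).
    by apply/funext => w; rewrite fct_sumE {1}(cn_decomp_map F w).
  have dr a := (dF a).1; have di a := (dF a).2.
  rewrite {1}FE derive_sum => [|a]; last first.
    by apply/diff_derivable/differentiableD; exact: differentiableZl.
  apply: eq_bigr => a _.
  have d1 := differentiableZl ((delta_mx 0 a, 0) : Cn R m) (dr a).
  have d2 := differentiableZl ((0, delta_mx 0 a) : Cn R m) (di a).
  have /diff_derivable e1 := d1; have /diff_derivable e2 := d2.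
  rewrite (deriveD (e1 v) (e2 v)).
  by congr (_ + _); exact: derive_scalel.
have := cn_decomp (\row_a 'D_v (fun w => complex.Re (zvec (F w) 0 a)) u,
  \row_a 'D_v (fun w => complex.Im (zvec (F w) 0 a)) u).
under eq_bigr do rewrite !mxE.
by move=> <-; apply/rowP => a; rewrite !mxE.
Qed.

Lemma cdiff_comp F (g : Cn R m -> R[i]) u : vdiff F u -> cdiff g (F u) ->
  cdiff (fun w => g (F w)) u.
Proof.
move=> /vdiff_differentiable dF [a b].
by split; [exact: (differentiable_comp dF a)|exact: (differentiable_comp dF b)].
Qed.

Lemma cD_comp F (g : Cn R m -> R[i]) u v : vdiff F u -> cdiff g (F u) ->
  cD v (fun w => g (F w)) u =
  \sum_a (dz a g (F u) * cD v (fun w => zvec (F w) 0 a) u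
    + dzb a g (F u) * Num.conj (cD v (fun w => zvec (F w) 0 a) u)).
Proof.
move=> dF dg; have dF' := vdiff_differentiable dF.
have -> : cD v (fun w => g (F w)) u = cD ('D_v F u) g (F u).
  have [a b] := dg; rewrite /cD; congr (_ +i* _).
    rewrite (deriveE _ (differentiable_comp dF' a)) (diff_comp dF' a) /=.
    by rewrite !deriveE.
  rewrite (deriveE _ (differentiable_comp dF' b)) (diff_comp dF' b) /=.
  by rewrite !deriveE.
by rewrite cDE// zvec_derive//; apply: eq_bigr => a _; rewrite mxE.
Qed.

Lemma dz_comp j F (g : Cn R m -> R[i]) u : vdiff F u -> cdiff g (F u) ->
  dz j (fun w => g (F w)) u =
  \sum_a (dz a g (F u) * dz j (fun w => zvec (F w) 0 a) u
    + dzb a g (F u) * Num.conj (dzb j (fun w => zvec (F w) 0 a) u)).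
Proof.
move=> dF dg; rewrite {1}/dz !cD_comp// mulr_sumr -sumrB mulr_sumr.
by apply: eq_bigr => a _; rewrite dz_alg.
Qed.

Lemma dzb_comp j F (g : Cn R m -> R[i]) u : vdiff F u -> cdiff g (F u) ->
  dzb j (fun w => g (F w)) u =
  \sum_a (dz a g (F u) * dzb j (fun w => zvec (F w) 0 a) u
    + dzb a g (F u) * Num.conj (dz j (fun w => zvec (F w) 0 a) u)).
Proof.
move=> dF dg; rewrite {1}/dzb !cD_comp// mulr_sumr -big_split/= mulr_sumr.
by apply: eq_bigr => a _; rewrite dzb_alg.
Qed.

End Chain.

Section RealChain.
Context {R : realType} {n : nat}.
Implicit Types (f N : Cn R n -> R) (u v : Cn R n).

Lemma cdiff_real f u : differentiable f u -> cdiff (fun w => (f w)%:C) u.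
Proof. by move=> df; split => //=; exact: differentiable_cst. Qed.

Lemma cdiff_rcomp N (g : R -> R) (g' : R) u : differentiable N u ->
  is_derive (N u) 1 g g' -> cdiff (fun w => (g (N w))%:C) u.
Proof.
move=> dN [/derivable1_diffP dg _]; apply: cdiff_real.
exact: (differentiable_comp dN dg).
Qed.

Lemma cD_rcomp N (g : R -> R) (g' : R) u v : differentiable N u ->
  is_derive (N u) 1 g g' ->
  cD v (fun w => (g (N w))%:C) u = g'%:C * cD v (fun w => (N w)%:C) u.
Proof.
move=> dN [/derivable1_diffP dg gE].
have E : 'D_v (fun w => g (N w)) u = g' * 'D_v N u.
  rewrite (deriveE _ (differentiable_comp dN dg)) (diff_comp dN dg) /=.
  by rewrite (diff1E dg) /= derive1E gE (deriveE _ dN) /GRing.scale /= mulrC.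
apply: complex_ext; rewrite ?cReMr ?cImMr /cD /=; first exact: E.
by rewrite !derive_cst mulr0.
Qed.

Lemma dz_rcomp j N (g : R -> R) (g' : R) u : differentiable N u ->
  is_derive (N u) 1 g g' ->
  dz j (fun w => (g (N w))%:C) u = g'%:C * dz j (fun w => (N w)%:C) u.
Proof.
move=> dN dg; rewrite /dz !(cD_rcomp _ dN dg).
move: (cD _ _ u) (cD _ _ u) 'i%C 2^-1 (g'%:C) => *; ring.
Qed.
Lemma dzb_rcomp j N (g : R -> R) (g' : R) u : differentiable N u ->
  is_derive (N u) 1 g g' ->
  dzb j (fun w => (g (N w))%:C) u = g'%:C * dzb j (fun w => (N w)%:C) u.
Proof.
move=> dN dg; rewrite /dzb !(cD_rcomp _ dN dg).
move: (cD _ _ u) (cD _ _ u) 'i%C 2^-1 (g'%:C) => *; ring.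
Qed.
End RealChain.

Section Smooth.
Context {R : realType} {n : nat}.
Implicit Types (U : set (Cn R n)) (u v : Cn R n) (f g : Cn R n -> R).

Lemma Ck_ext k U f g : open U -> (forall u, U u -> f u = g u) ->
  Ck k U f -> Ck k U g.
Proof.
move=> oU; elim: k f g => [|k IH] f g fg /=.
  move=> cf u Uu; have nfg : \near u, f u = g u.
    by apply: filterS (open_nbhs_nbhs (conj oU Uu)) => w /fg.
  rewrite /prop_for /continuous_at -(fg _ Uu).
  by apply: cvg_trans (cf u Uu); apply: near_eq_cvg.
have nfg u : U u -> \near u, f u = g u.
  by move=> Uu; apply: filterS (open_nbhs_nbhs (conj oU Uu)) => w /fg.
move=> [df cf]; split=> [u Uu|v].
  exact: near_differentiable (nfg u Uu) (df u Uu).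
apply: IH (cf v) => u Uu; apply: near_eq_derive; exact: nfg.
Qed.


Lemma CkD k U f g : open U -> Ck k U f -> Ck k U g -> Ck k U (fun w => f w + g w).
Proof.
move=> oU; elim: k f g => [|k IH] f g /=.
  by move=> cf cg u Uu; apply: cvgD; [exact: cf|exact: cg].
move=> [df cf] [dg cg]; split=> [u Uu|v].
  by apply: differentiableD; [exact: df|exact: dg].
apply: (Ck_ext oU _ (IH _ _ (cf v) (cg v))) => u Uu.
by rewrite (deriveD (diff_derivable (df u Uu)) (diff_derivable (dg u Uu))).
Qed.

Lemma CkZ k U f (a : R) : open U -> Ck k U f -> Ck k U (fun w => a * f w).
Proof.
move=> oU; elim: k f => [|k IH] f /=.
  by move=> cf u Uu; apply: cvgM; [exact: cvg_cst|exact: cf].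
move=> [df cf]; split=> [u Uu|v].
  by apply: differentiableZ; exact: df.
apply: (Ck_ext oU _ (IH _ (cf v))) => u Uu.
by rewrite (deriveZ a (diff_derivable (df u Uu))).
Qed.

Lemma Ck_cst k U (a : R) : Ck k U (fun=> a).
Proof.
elim: k a => [|k IH] a /=; first by move=> u _; exact: cvg_cst.
split=> [u _|v]; first exact: differentiable_cst.
have -> : (fun u : Cn R n => 'D_v (fun=> a) u) = (fun=> 0) by apply/funext => u; rewrite derive_cst.
exact: IH.
Qed.

Lemma Ck_sub k (U V : set (Cn R n)) f : V `<=` U -> Ck k U f -> Ck k V f.
Proof.
move=> VU; elim: k f => [|k IH] f /=; first by move=> cf u /VU; exact: cf.
move=> [df cf]; split=> [u /VU|v]; first exact: df.
exact/IH/cf.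
Qed.

Implicit Types F G : Cn R n -> R[i].

Lemma csmoothD U F G : open U -> csmooth U F -> csmooth U G ->
  csmooth U (fun w => F w + G w).
Proof.
move=> oU [a b] [c d]; split=> k.
  by under eq_fun do rewrite cReD; apply: CkD.
by under eq_fun do rewrite cImD; apply: CkD.
Qed.

Lemma csmoothZ U F (c : R[i]) : open U -> csmooth U F ->
  csmooth U (fun w => c * F w).
Proof.
move=> oU [a b]; split=> k.
  under eq_fun do rewrite cReM -mulNr.
  by apply: CkD => //; exact: CkZ.
under eq_fun do rewrite cImM.
by apply: CkD => //; exact: CkZ.
Qed.

Lemma csmooth_cst U (c : R[i]) : csmooth U (fun=> c).
Proof. by split=> k; exact: Ck_cst. Qed.

Lemma csmooth_sub U V F : V `<=` U -> csmooth U F -> csmooth V F.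
Proof. by move=> VU [a b]; split=> k; [exact: Ck_sub VU (a k)|exact: Ck_sub VU (b k)]. Qed.

Lemma csmooth_cD U F v : csmooth U F -> csmooth U (cD v F).
Proof. by move=> [a b]; split=> k; [have [_] := a k.+1|have [_] := b k.+1]; exact. Qed.

Lemma csmooth_diff U F u : csmooth U F -> U u -> cdiff F u.
Proof. by move=> [a b] Uu; split; [have [+ _] := a 1%N|have [+ _] := b 1%N]; exact. Qed.

Lemma csmooth_dz U F j : open U -> csmooth U F -> csmooth U (dz j F).
Proof.
move=> oU sF; apply: csmoothZ => //.
under eq_fun do rewrite -mulNr.
apply: csmoothD => //; first exact: csmooth_cD.
by apply: csmoothZ => //; exact: csmooth_cD.
Qed.

Lemma csmooth_dzb U F j : open U -> csmooth U F -> csmooth U (dzb j F).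
Proof.
move=> oU sF; apply: csmoothZ => //.
apply: csmoothD => //; first exact: csmooth_cD.
by apply: csmoothZ => //; exact: csmooth_cD.
Qed.

Lemma cD_comm U F u v w : open U -> csmooth U F -> U u ->
  cD v (cD w F) u = cD w (cD v F) u.
Proof.
move=> oU sF Uu.
have nU : \forall x \near u, U x := open_nbhs_nbhs (conj oU Uu).
have d x : U x -> cdiff F x by exact: csmooth_diff.
have dv := csmooth_diff (csmooth_cD v sF) Uu.
have dw := csmooth_diff (csmooth_cD w sF) Uu.
apply: complex_ext => /=; apply: derive_comm.
- by apply: filterS nU => x /d[].
- by case: dw.
- by case: dv.
- by apply: filterS nU => x /d[].
- by case: dw.
- by case: dv.
Qed.

Lemma cDZ F u v (c : R[i]) : cdiff F u -> cD v (fun w => c * F w) u = c * cD v F u.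
Proof.
by move=> dF; rewrite cDM ?cD_cst ?mul0r ?add0r//; exact: cdiff_cst.
Qed.

Lemma cdiffZ F u (c : R[i]) : cdiff F u -> cdiff (fun w => c * F w) u.
Proof. by move=> dF; apply: cdiffM => //; exact: cdiff_cst. Qed.

Lemma cD_dz F u v j : (forall w, cdiff (cD w F) u) ->
  cD v (dz j F) u =
  2^-1 * (cD v (cD (delta_mx 0 j, 0) F) u - 'i%C * cD v (cD (0, delta_mx 0 j) F) u).
Proof.
move=> d; rewrite /dz cDZ.
  by under eq_fun do rewrite -mulNr; rewrite cDD ?cDZ ?mulNr//; exact: cdiffZ.
by under eq_fun do rewrite -mulNr; apply: cdiffD => //; exact: cdiffZ.
Qed.

Lemma cD_dzb F u v j : (forall w, cdiff (cD w F) u) ->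
  cD v (dzb j F) u =
  2^-1 * (cD v (cD (delta_mx 0 j, 0) F) u + 'i%C * cD v (cD (0, delta_mx 0 j) F) u).
Proof.
move=> d; rewrite /dzb cDZ.
  by rewrite cDD ?cDZ//; exact: cdiffZ.
by apply: cdiffD => //; exact: cdiffZ.
Qed.

(** Each operator combines two real directions, so this reduces to the symmetry
    of real second derivatives. *)
Lemma dzb_dz U F u j k : open U -> csmooth U F -> U u ->
  dzb j (dz k F) u = dz k (dzb j F) u.
Proof.
move=> oU sF Uu.
have d w : cdiff (cD w F) u := csmooth_diff (csmooth_cD w sF) Uu.
rewrite -[LHS]/(2^-1 * (cD _ (dz k F) u + 'i%C * cD _ (dz k F) u)).
rewrite -[RHS]/(2^-1 * (cD _ (dzb j F) u - 'i%C * cD _ (dzb j F) u)).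
rewrite !(cD_dz _ _ d) !(cD_dzb _ _ d).
by apply: dzb_dz_alg; exact: (cD_comm _ _ oU sF Uu).
Qed.

Lemma dz_dz U F u j k : open U -> csmooth U F -> U u ->
  dz j (dz k F) u = dz k (dz j F) u.
Proof.
move=> oU sF Uu.
have d w : cdiff (cD w F) u := csmooth_diff (csmooth_cD w sF) Uu.
rewrite -[LHS]/(2^-1 * (cD _ (dz k F) u - 'i%C * cD _ (dz k F) u)).
rewrite -[RHS]/(2^-1 * (cD _ (dz j F) u - 'i%C * cD _ (dz j F) u)).
rewrite !(cD_dz _ _ d).
by apply: dz_dz_alg; exact: (cD_comm _ _ oU sF Uu).
Qed.

(** The conditions of [holo] on one component, so that components can be
    differentiated repeatedly. *)
Definition hol U F := csmooth U F /\ forall u, U u -> forall j, dzb j F u = 0.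

Lemma hol_dz U F k : open U -> hol U F -> hol U (dz k F).
Proof.
move=> oU [sF hF]; split; first exact: csmooth_dz.
move=> u Uu j; rewrite (dzb_dz _ _ oU sF Uu).
rewrite -(dz_cst k 0 u); apply: dz_near.
by apply: filterS (open_nbhs_nbhs (conj oU Uu)) => x /hF.
Qed.

End Smooth.

(** * Matrix-valued functions and the curvature along a direction *)

(** [A^t*] with entries in R[i] itself rather than in its closed field structure,
    which gives all matrix products one syntactic form. *)
Definition adj {R : realType} {p q} (A : 'M[R[i]]_(p, q)) : 'M[R[i]]_(q, p) :=
  (A^t*)%sesqui.
Notation "A ^H" := (adj A) (at level 1, left associativity, format "A ^H").

Section Adjoint.
Context {R : realType}.
Implicit Types p q r : nat.
Lemma addmxE p q (A B : 'M[R[i]]_(p, q)) i j : (A + B) i j = A i j + B i j.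
Proof. by rewrite mxE. Qed.
Lemma oppmxE p q (A : 'M[R[i]]_(p, q)) i j : (- A) i j = - A i j.
Proof. by rewrite mxE. Qed.
Lemma scalemxE p q c (A : 'M[R[i]]_(p, q)) i j : (c *: A) i j = c * A i j.
Proof. by rewrite mxE. Qed.
Lemma adjE p q (A : 'M[R[i]]_(p, q)) i j : A^H i j = Num.conj (A j i).
Proof. by rewrite /adj !mxE. Qed.
Lemma adjM p q r (A : 'M[R[i]]_(p, q)) (B : 'M[R[i]]_(q, r)) :
  (A *m B)^H = B^H *m A^H.
Proof. by rewrite /adj trmx_mul map_mxM. Qed.
Lemma adjK p q (A : 'M[R[i]]_(p, q)) : A^H^H = A.
Proof. by apply/matrixP => a b; rewrite !adjE conjCK. Qed.
Lemma adjD p q (A B : 'M[R[i]]_(p, q)) : (A + B)^H = A^H + B^H.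
Proof. by apply/matrixP => a b; rewrite adjE 2!addmxE 2!adjE rmorphD. Qed.
Lemma adjN p q (A : 'M[R[i]]_(p, q)) : (- A)^H = - A^H.
Proof. by apply/matrixP => a b; rewrite adjE 2!oppmxE adjE rmorphN. Qed.
Lemma adjZ p q c (A : 'M[R[i]]_(p, q)) : (c *: A)^H = Num.conj c *: A^H.
Proof. by apply/matrixP => a b; rewrite adjE 2!scalemxE adjE rmorphM. Qed.
Lemma adj0 p q : (0 : 'M[R[i]]_(p, q))^H = 0.
Proof. by apply/matrixP => a b; rewrite adjE !mxE conjC0. Qed.
Lemma adj_sum p q I (r : seq I) (F : I -> 'M[R[i]]_(p, q)) :
  (\sum_(i <- r) F i)^H = \sum_(i <- r) (F i)^H.
Proof.
elim: r => [|i r IH]; first by rewrite !big_nil adj0.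
by rewrite !big_cons adjD IH.
Qed.
End Adjoint.

Section MatrixCalculus.
Context {R : realType} {n : nat}.
Implicit Types (u : Cn R n) (j k : 'I_n).

Definition mdz {p q} j (F : Cn R n -> 'M[R[i]]_(p, q)) u : 'M[R[i]]_(p, q) :=
  \matrix_(a, b) dz j (fun w => F w a b) u.
Definition mdzb {p q} j (F : Cn R n -> 'M[R[i]]_(p, q)) u : 'M[R[i]]_(p, q) :=
  \matrix_(a, b) dzb j (fun w => F w a b) u.
Definition mdiff {p q} (F : Cn R n -> 'M[R[i]]_(p, q)) u :=
  forall a b, cdiff (fun w => F w a b) u.

Section Dims.
Context {p q r : nat}.
Implicit Types F : Cn R n -> 'M[R[i]]_(p, q).

Lemma mdz_near j F F' u : (\near u, F u = F' u) -> mdz j F u = mdz j F' u.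
Proof.
by move=> E; apply/matrixP => a b; rewrite !mxE; apply: dz_near; apply: filterS E => w ->.
Qed.
Lemma mdzb_near j F F' u : (\near u, F u = F' u) -> mdzb j F u = mdzb j F' u.
Proof.
by move=> E; apply/matrixP => a b; rewrite !mxE; apply: dzb_near; apply: filterS E => w ->.
Qed.
Lemma mdiff_near F F' u : (\near u, F u = F' u) -> mdiff F u -> mdiff F' u.
Proof.
by move=> E d a b; apply: cdiff_near (d a b); apply: filterS E => w ->.
Qed.

Lemma mdiffD F F' u : mdiff F u -> mdiff F' u -> mdiff (fun w => F w + F' w) u.
Proof.
move=> dF dF' a b; under eq_fun do rewrite mxE.
exact: cdiffD.
Qed.
Lemma mdzD j F F' u : mdiff F u -> mdiff F' u ->
  mdz j (fun w => F w + F' w) u = mdz j F u + mdz j F' u.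
Proof.
move=> dF dF'; apply/matrixP => a b; rewrite !mxE.
under eq_fun do rewrite mxE.
exact: dzD.
Qed.
Lemma mdzbD j F F' u : mdiff F u -> mdiff F' u ->
  mdzb j (fun w => F w + F' w) u = mdzb j F u + mdzb j F' u.
Proof.
move=> dF dF'; apply/matrixP => a b; rewrite !mxE.
under eq_fun do rewrite mxE.
exact: dzbD.
Qed.

Lemma mdiffM F (F' : Cn R n -> 'M[R[i]]_(q, r)) u : mdiff F u -> mdiff F' u ->
  mdiff (fun w => F w *m F' w) u.
Proof.
move=> dF dF' a b; under eq_fun do rewrite mxE.
by apply: cdiff_sum => c; exact: cdiffM.
Qed.
Lemma mdzM j F (F' : Cn R n -> 'M[R[i]]_(q, r)) u : mdiff F u -> mdiff F' u ->
  mdz j (fun w => F w *m F' w) u = mdz j F u *m F' u + F u *m mdz j F' u.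
Proof.
move=> dF dF'; apply/matrixP => a b; rewrite !mxE -big_split /=.
under eq_fun do rewrite mxE.
rewrite dz_sum => [|c]; last exact: cdiffM.
by apply: eq_bigr => c _; rewrite !mxE dzM.
Qed.
Lemma mdzbM j F (F' : Cn R n -> 'M[R[i]]_(q, r)) u : mdiff F u -> mdiff F' u ->
  mdzb j (fun w => F w *m F' w) u = mdzb j F u *m F' u + F u *m mdzb j F' u.
Proof.
move=> dF dF'; apply/matrixP => a b; rewrite !mxE -big_split /=.
under eq_fun do rewrite mxE.
rewrite dzb_sum => [|c]; last exact: cdiffM.
by apply: eq_bigr => c _; rewrite !mxE dzbM.
Qed.

Lemma mdiff_adj F u : mdiff F u -> mdiff (fun w => (F w)^H) u.
Proof.
move=> dF a b; under eq_fun do rewrite adjE.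
exact: cdiff_conj.
Qed.
Lemma mdz_adj j F u : mdiff F u -> mdz j (fun w => (F w)^H) u = (mdzb j F u)^H.
Proof.
move=> dF; apply/matrixP => a b; rewrite adjE [LHS]mxE [in RHS]mxE.
under eq_fun do rewrite adjE.
exact: dz_conj.
Qed.
Lemma mdzb_adj j F u : mdiff F u -> mdzb j (fun w => (F w)^H) u = (mdz j F u)^H.
Proof.
move=> dF; apply/matrixP => a b; rewrite adjE [LHS]mxE [in RHS]mxE.
under eq_fun do rewrite adjE.
exact: dzb_conj.
Qed.

Lemma mdiffZ (c : R[i]) F u : mdiff F u -> mdiff (fun w => c *: F w) u.
Proof.
move=> dF a b; under eq_fun do rewrite mxE.
exact: cdiffZ.
Qed.
Lemma mdzZ j (c : R[i]) F u : mdiff F u -> mdz j (fun w => c *: F w) u = c *: mdz j F u.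
Proof.
move=> dF; apply/matrixP => a b; rewrite !mxE.
under eq_fun do rewrite mxE.
by rewrite dzM ?dz_cst ?mul0r ?add0r//; exact: cdiff_cst.
Qed.
Lemma mdzbZ j (c : R[i]) F u : mdiff F u -> mdzb j (fun w => c *: F w) u = c *: mdzb j F u.
Proof.
move=> dF; apply/matrixP => a b; rewrite !mxE.
under eq_fun do rewrite mxE.
by rewrite dzbM ?dzb_cst ?mul0r ?add0r//; exact: cdiff_cst.
Qed.

End Dims.

Definition Dz {p q} (xi : 'rV[R[i]]_n) (F : Cn R n -> 'M[R[i]]_(p, q)) u :=
  \sum_j xi 0 j *: mdz j F u.
Definition Dzb {p q} (xi : 'rV[R[i]]_n) (F : Cn R n -> 'M[R[i]]_(p, q)) u :=
  \sum_j Num.conj (xi 0 j) *: mdzb j F u.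
Definition DDb {p q} (xi : 'rV[R[i]]_n) (F : Cn R n -> 'M[R[i]]_(p, q)) u :=
  \sum_j \sum_k (xi 0 j * Num.conj (xi 0 k)) *: mdz j (mdzb k F) u.

Lemma DzZ {p q} (c : R[i]) xi (F : Cn R n -> 'M[R[i]]_(p, q)) u :
  Dz (c *: xi) F u = c *: Dz xi F u.
Proof.
by rewrite /Dz scaler_sumr; apply: eq_bigr => j _; rewrite mxE scalerA.
Qed.
Lemma DDbZ {p q} (c : R[i]) xi (F : Cn R n -> 'M[R[i]]_(p, q)) u :
  DDb (c *: xi) F u = (c * Num.conj c) *: DDb xi F u.
Proof.
rewrite /DDb scaler_sumr; apply: eq_bigr => j _.
rewrite scaler_sumr; apply: eq_bigr => k _; rewrite !mxE rmorphM scalerA.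
by rewrite mulrACA.
Qed.
Lemma DzD {p q} xi xi' (F : Cn R n -> 'M[R[i]]_(p, q)) u :
  Dz (xi + xi') F u = Dz xi F u + Dz xi' F u.
Proof.
by rewrite /Dz -big_split; apply: eq_bigr => j _; rewrite mxE scalerDl.
Qed.

Lemma Dzb_adj {p} xi (F : Cn R n -> 'M[R[i]]_p) u :
  (\near u, (F u)^H = F u) -> mdiff F u -> Dzb xi F u = (Dz xi F u)^H.
Proof.
move=> hF dF; rewrite /Dz /Dzb adj_sum.
apply: eq_bigr => j _; rewrite adjZ; congr (_ *: _).
by rewrite -mdzb_adj//; apply: mdzb_near; apply: filterS hF => w ->.
Qed.

(** Contracting the four indices with one vector turns the coordinate formula into
    the curvature matrix of the Chern connection, evaluated on xi. *)
Lemma curvature4E (G : Cn R n -> 'M[R[i]]_n) u xi :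
  curvature4 G u xi xi xi xi =
  (xi *m (- DDb xi G u + Dz xi G u *m invmx (G u) *m Dzb xi G u) *m xi^H) 0 0.
Proof.
have -> : - DDb xi G u + Dz xi G u *m invmx (G u) *m Dzb xi G u =
   \sum_j \sum_k (xi 0 j * Num.conj (xi 0 k)) *: (- mdz j (mdzb k G) u +
      mdz j G u *m invmx (G u) *m mdzb k G u).
  rewrite /DDb /Dz /Dzb mulmx_suml mulmx_suml -sumrN -big_split /=.
  apply: eq_bigr => j _; rewrite mulmx_sumr -sumrN -big_split /=.
  apply: eq_bigr => k _; rewrite scalerDr scalerN; congr (_ + _).
  by rewrite -!scalemxAl -scalemxAr scalerA.
rewrite /curvature4 mulmx_sumr mulmx_suml summxE; apply: eq_bigr => j _.
rewrite mulmx_sumr mulmx_suml summxE; apply: eq_bigr => k _.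
rewrite -scalemxAr -scalemxAl mxE.
set A := - _ + _.
have -> : (xi *m A *m xi^H) 0 0 = \sum_l \sum_m A l m * xi 0 l * Num.conj (xi 0 m).
  rewrite mxE exchange_big /=; apply: eq_bigr => m _.
  by rewrite adjE mxE mulr_suml; apply: eq_bigr => l _; rewrite [xi 0 l * _]mulrC.
rewrite mulr_sumr; apply: eq_bigr => l _; rewrite mulr_sumr; apply: eq_bigr => m _.
have -> : curvature G u j k l m = A l m.
  have e1 : mdz j (mdzb k G) u l m = dz j (dzb k (fun w => G w l m)) u.
    by rewrite [LHS]mxE; under eq_fun do rewrite mxE.
  have e2 : (mdz j G u *m invmx (G u) *m mdzb k G u) l m =
      \sum_a \sum_c invmx (G u) c a * dz j (fun w => G w l c) u *
         dzb k (fun w => G w a m) u.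
    rewrite mxE; apply: eq_bigr => a _; rewrite [mdzb k G u a m]mxE.
    rewrite [X in X * _]mxE mulr_suml; apply: eq_bigr => c _.
    by rewrite [mdz j G u l c]mxE; congr (_ * _); rewrite mulrC.
  have -> : A l m = - mdz j (mdzb k G) u l m + (mdz j G u *m invmx (G u) *m mdzb k G u) l m.
    by rewrite /A [LHS]mxE; congr (_ + _); rewrite [LHS]mxE.
  by rewrite e1 e2.
have alg (a x y z w : R[i]) : a * x * y * z * w = x * y * (a * z * w) by ring.
exact: alg.
Qed.

End MatrixCalculus.

(** * Metrics pulled back by a holomorphic map *)

Section MatrixClasses.
Context {R : realType} {n : nat}.
Implicit Types (u : Cn R n) (j k : 'I_n).

Lemma open_near (U : set (Cn R n)) (P : Cn R n -> Prop) u :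
  open U -> U u -> (forall w, U w -> P w) -> \forall w \near u, P w.
Proof. by move=> oU Uu UP; exact: filterS UP (open_nbhs_nbhs (conj oU Uu)). Qed.

Definition mhol {p q} (U : set (Cn R n)) (M : Cn R n -> 'M[R[i]]_(p, q)) :=
  forall a b, hol U (fun w => M w a b).
Definition msmooth {p q} (U : set (Cn R n)) (M : Cn R n -> 'M[R[i]]_(p, q)) :=
  forall a b, csmooth U (fun w => M w a b).

Lemma msmooth_mdiff {p q} U (M : Cn R n -> 'M[R[i]]_(p, q)) u :
  msmooth U M -> U u -> mdiff M u.
Proof. by move=> s Uu a b; exact: csmooth_diff (s a b) Uu. Qed.

Lemma msmooth_mdzb {p q} U (M : Cn R n -> 'M[R[i]]_(p, q)) j :
  open U -> msmooth U M -> msmooth U (mdzb j M).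
Proof.
move=> oU s a b; under eq_fun do rewrite mxE.
exact: csmooth_dzb.
Qed.
Lemma mhol_msmooth {p q} U (M : Cn R n -> 'M[R[i]]_(p, q)) : mhol U M -> msmooth U M.
Proof. by move=> h a b; have [] := h a b. Qed.
Lemma mhol_mdz {p q} U (M : Cn R n -> 'M[R[i]]_(p, q)) j :
  open U -> mhol U M -> mhol U (mdz j M).
Proof.
move=> oU s a b.
have -> : (fun w => mdz j M w a b) = dz j (fun w => M w a b).
  by apply/funext => w; rewrite mxE.
exact: hol_dz.
Qed.
Lemma mhol_mdzb0 {p q} U (M : Cn R n -> 'M[R[i]]_(p, q)) j u :
  mhol U M -> U u -> mdzb j M u = 0.
Proof. by move=> h Uu; apply/matrixP => a b; rewrite !mxE; have [_ ->] := h a b. Qed.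

End MatrixClasses.

Section PullMetric.
Context {R : realType} {n : nat}.
Implicit Types (u : Cn R n) (j k : 'I_n).

Section Map.
Context {l : nat} (U : set (Cn R n)) (m : Cn R n -> Cn R l).
Hypotheses (oU : open U) (hm : forall a, hol U (fun w => zvec (m w) 0 a)).

Lemma jac_mhol : mhol U (jac m).
Proof.
move=> j a; have -> : (fun w => jac m w j a) = dz j (fun w => zvec (m w) 0 a).
  by apply/funext => w; rewrite mxE.
exact: hol_dz.
Qed.

Lemma hol_vdiff u : U u -> vdiff m u.
Proof. by move=> Uu a; have [s _] := hm a; exact: csmooth_diff s Uu. Qed.

Context {p q : nat} (V : set (Cn R l)) (H : Cn R l -> 'M[R[i]]_(p, q)).

Lemma mdiff_pull u : U u -> mdiff H (m u) -> mdiff (fun w => H (m w)) u.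
Proof. by move=> Uu d a b; apply: (cdiff_comp (hol_vdiff Uu) (d a b)). Qed.

Lemma mdz_pull u j : U u -> mdiff H (m u) ->
  mdz j (fun w => H (m w)) u = \sum_a jac m u j a *: mdz a H (m u).
Proof.
move=> Uu d; apply/matrixP => a b; rewrite summxE mxE.
rewrite (dz_comp j (hol_vdiff Uu) (d a b)); apply: eq_bigr => c _.
have [_ ->] := hm c; rewrite // conjC0 mulr0 addr0.
by rewrite [RHS]mxE [jac m u j c]mxE [mdz c H _ a b]mxE mulrC.
Qed.

Lemma mdzb_pull u j : U u -> mdiff H (m u) ->
  mdzb j (fun w => H (m w)) u = \sum_a Num.conj (jac m u j a) *: mdzb a H (m u).
Proof.
move=> Uu d; apply/matrixP => a b; rewrite summxE mxE.
rewrite (dzb_comp j (hol_vdiff Uu) (d a b)); apply: eq_bigr => c _.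
have [_ ->] := hm c; rewrite // mulr0 add0r.
by rewrite [RHS]mxE [jac m u j c]mxE [mdzb c H _ a b]mxE mulrC.
Qed.

Lemma Dz_pull u xi : U u -> mdiff H (m u) ->
  Dz xi (fun w => H (m w)) u = Dz (xi *m jac m u) H (m u).
Proof.
move=> Uu d; rewrite /Dz.
under eq_bigr do rewrite (mdz_pull _ Uu d) scaler_sumr.
rewrite exchange_big /=; apply: eq_bigr => a _; rewrite mxE scaler_suml.
by apply: eq_bigr => j _; rewrite scalerA.
Qed.

Hypotheses (oV : open V) (UV : forall u, U u -> V (m u)) (sH : msmooth V H).

Lemma mdiff_mdzb_pull u k : U u -> mdiff (mdzb k (fun w => H (m w))) u.
Proof.
move=> Uu a b.
have near_E : \forall w \near u, \sum_c Num.conj (jac m w k c) * mdzb c H (m w) a b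
   = mdzb k (fun w => H (m w)) w a b.
  apply: (open_near oU Uu) => w Uw.
  rewrite (mdzb_pull _ Uw) ?summxE//; last exact: msmooth_mdiff (UV Uw).
  by apply: eq_bigr => c _; rewrite [RHS]mxE.
apply: cdiff_near near_E _; apply: cdiff_sum => c; apply: cdiffM.
  by apply: cdiff_conj; exact: (msmooth_mdiff (mhol_msmooth jac_mhol) Uu).
exact: (cdiff_comp (hol_vdiff Uu) (msmooth_mdiff (msmooth_mdzb c oV sH) (UV Uu) a b)).
Qed.

Lemma mdz_mdzb_pull u j k : U u -> mdz j (mdzb k (fun w => H (m w))) u =
   \sum_b \sum_a (jac m u j a * Num.conj (jac m u k b)) *: mdz a (mdzb b H) (m u).
Proof.
move=> Uu; apply/matrixP => c d; rewrite mxE.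
have near_E : \forall w \near u, mdzb k (fun w => H (m w)) w c d =
   \sum_b Num.conj (jac m w k b) * mdzb b H (m w) c d.
  apply: (open_near oU Uu) => w Uw.
  rewrite (mdzb_pull _ Uw) ?summxE//; last exact: msmooth_mdiff (UV Uw).
  by apply: eq_bigr => e _; rewrite [LHS]mxE.
have d1 b : cdiff (fun w => jac m w k b) u.
  exact: (msmooth_mdiff (mhol_msmooth jac_mhol) Uu).
have dH b := msmooth_mdiff (msmooth_mdzb b oV sH) (UV Uu).
have d2 b := cdiff_comp (hol_vdiff Uu) (dH b c d).
rewrite (dz_near _ near_E) dz_sum; last by move=> b; apply: cdiffM (d2 b); exact: cdiff_conj.
rewrite summxE; apply: eq_bigr => b _.
rewrite (dzM _ (cdiff_conj (d1 b)) (d2 b)) (dz_conj _ (d1 b)).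
have [_ ->] := jac_mhol k b; rewrite // conjC0 mul0r add0r.
rewrite (dz_comp _ (hol_vdiff Uu) (dH b c d)) summxE mulr_sumr.
apply: eq_bigr => a _; have [_ ->] := hm a => //.
rewrite conjC0 mulr0 addr0 [RHS]mxE [jac m u j a]mxE [mdz a _ _ c d]mxE.
move: (dz _ _ _) (dz _ _ _) (Num.conj _) => x y z.
by rewrite mulrCA mulrC [z * x]mulrC.
Qed.

(** Only the mixed derivatives of H survive, because m is holomorphic: no second
    derivative of m enters. *)
Lemma DDb_pull u xi : U u ->
  DDb xi (fun w => H (m w)) u = DDb (xi *m jac m u) H (m u).
Proof.
move=> Uu; rewrite /DDb.
transitivity (\sum_j \sum_k \sum_b \sum_a
  ((xi 0 j * jac m u j a) * Num.conj (xi 0 k * jac m u k b))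
     *: mdz a (mdzb b H) (m u)).
  apply: eq_bigr => j _; apply: eq_bigr => k _.
  rewrite (mdz_mdzb_pull _ _ Uu) scaler_sumr; apply: eq_bigr => b _.
  rewrite scaler_sumr; apply: eq_bigr => a _; rewrite scalerA rmorphM; congr (_ *: _).
  by rewrite mulrACA.
rewrite [RHS]exchange_big /=.
under eq_bigr do rewrite exchange_big /=.
rewrite exchange_big /=; apply: eq_bigr => b _.
under eq_bigr do rewrite exchange_big /=.
rewrite exchange_big /=; apply: eq_bigr => a _.
rewrite !mxE mulr_suml scaler_suml; apply: eq_bigr => j _.
rewrite rmorph_sum mulr_sumr scaler_suml; apply: eq_bigr => k _.
by [].
Qed.

End Map.

Section Sandwich.
Context {p q : nat} (U : set (Cn R n)) (M : Cn R n -> 'M[R[i]]_(p, q))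
  (K : Cn R n -> 'M[R[i]]_q) (u : Cn R n) (xi : 'rV[R[i]]_n).
Hypotheses (oU : open U) (hM : mhol U M) (Uu : U u)
  (dK : forall w, U w -> mdiff K w) (ddK : forall k, mdiff (mdzb k K) u).

Let dM w : U w -> mdiff M w.
Proof. by move=> Uw; exact: msmooth_mdiff (mhol_msmooth hM) Uw. Qed.
Let dMa w : U w -> mdiff (fun w => (M w)^H) w.
Proof. by move=> Uw; exact/mdiff_adj/dM. Qed.

Let P w := M w *m K w *m (M w)^H.

Lemma sandwich_mdiff w : U w -> mdiff P w.
Proof. by move=> Uw; apply: mdiffM (dMa Uw); apply: mdiffM (dM Uw) (dK Uw). Qed.

Lemma mdz_sandwich j : mdz j P u =
  mdz j M u *m K u *m (M u)^H + M u *m mdz j K u *m (M u)^H.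
Proof.
rewrite mdzM; [|exact: mdiffM (dM Uu) (dK Uu)|exact: dMa].
rewrite (mdzM _ (dM Uu) (dK Uu)) mdz_adj; last exact: dM.
by rewrite (mhol_mdzb0 _ hM Uu) adj0 mulmx0 addr0 mulmxDl.
Qed.

Lemma mdzb_sandwich k w : U w -> mdzb k P w =
  M w *m mdzb k K w *m (M w)^H + M w *m K w *m (mdz k M w)^H.
Proof.
move=> Uw; rewrite mdzbM; [|exact: mdiffM (dM Uw) (dK Uw)|exact: dMa].
rewrite (mdzbM _ (dM Uw) (dK Uw)) mdzb_adj; last exact: dM.
by rewrite (mhol_mdzb0 _ hM Uw) mul0mx add0r.
Qed.

Let ddM k : mhol U (mdz k M).
Proof. exact: mhol_mdz. Qed.
Let Q k w := M w *m mdzb k K w *m (M w)^H + M w *m K w *m (mdz k M w)^H.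

Let near_Q k : \forall w \near u, mdzb k P w = Q k w.
Proof. by apply: (open_near oU Uu) => w Uw; exact: mdzb_sandwich. Qed.

Let dmM k : mdiff (mdz k M) u.
Proof. exact: msmooth_mdiff (mhol_msmooth (ddM k)) Uu. Qed.

Lemma mdiff_mdzb_sandwich k : mdiff (mdzb k P) u.
Proof.
apply: (@mdiff_near _ _ _ _ (Q k)).
  by apply: filterS (near_Q k) => w ->.
apply: mdiffD.
  exact: mdiffM (mdiffM (dM Uu) (ddK k)) (dMa Uu).
exact: mdiffM (mdiffM (dM Uu) (dK Uu)) (mdiff_adj (dmM k)).
Qed.

Lemma mdz_mdzb_sandwich j k : mdz j (mdzb k P) u =
  mdz j M u *m mdzb k K u *m (M u)^H + M u *m mdz j (mdzb k K) u *m (M u)^H +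
  (mdz j M u *m K u *m (mdz k M u)^H + M u *m mdz j K u *m (mdz k M u)^H).
Proof.
have d1 := mdiffM (dM Uu) (ddK k); have d2 := mdiffM (dM Uu) (dK Uu).
have d3 := mdiff_adj (dmM k).
rewrite (mdz_near _ (near_Q k)) (mdzD _ (mdiffM d1 (dMa Uu)) (mdiffM d2 d3)).
rewrite (mdzM _ d1 (dMa Uu)) (mdzM _ d2 d3) (mdzM _ (dM Uu) (ddK k)) (mdzM _ (dM Uu) (dK Uu)).
rewrite (mdz_adj _ (dM Uu)) (mdz_adj _ (dmM k)).
rewrite (mhol_mdzb0 _ hM Uu) (mhol_mdzb0 _ (ddM k) Uu).
by rewrite !adj0 !mulmx0 !addr0 !mulmxDl.
Qed.

Lemma Dz_sandwich : Dz xi P u =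
  Dz xi M u *m K u *m (M u)^H + M u *m Dz xi K u *m (M u)^H.
Proof.
rewrite /Dz !mulmx_sumr !mulmx_suml -big_split /=; apply: eq_bigr => j _.
by rewrite mdz_sandwich scalerDr -!scalemxAl -!scalemxAr -!scalemxAl.
Qed.

(** M being holomorphic, Db differentiates only K and M^H, and D only M and K. *)
Lemma DDb_sandwich : DDb xi P u =
  Dz xi M u *m Dzb xi K u *m (M u)^H + M u *m DDb xi K u *m (M u)^H +
  (Dz xi M u *m K u *m (Dz xi M u)^H + M u *m Dz xi K u *m (Dz xi M u)^H).
Proof.
transitivity (\sum_j \sum_k (xi 0 j * Num.conj (xi 0 k)) *: (
  mdz j M u *m mdzb k K u *m (M u)^H + M u *m mdz j (mdzb k K) u *m (M u)^H +
  (mdz j M u *m K u *m (mdz k M u)^H + M u *m mdz j K u *m (mdz k M u)^H))).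
  by apply: eq_bigr => j _; apply: eq_bigr => k _; rewrite mdz_mdzb_sandwich.
under eq_bigr do under eq_bigr do rewrite !scalerDr.
under eq_bigr do rewrite !big_split.
rewrite !big_split /=; congr (_ + _ + (_ + _)).
- rewrite /Dz /Dzb !mulmx_suml; apply: eq_bigr => j _.
  rewrite mulmx_sumr mulmx_suml; apply: eq_bigr => k _.
  by rewrite -!scalemxAl -!scalemxAr -!scalemxAl scalerA.
- rewrite /DDb mulmx_sumr mulmx_suml; apply: eq_bigr => j _.
  rewrite mulmx_sumr mulmx_suml; apply: eq_bigr => k _.
  by rewrite -!scalemxAr -!scalemxAl.
- rewrite /Dz !mulmx_suml; apply: eq_bigr => j _.
  rewrite adj_sum mulmx_sumr; apply: eq_bigr => k _.
  by rewrite adjZ -!scalemxAl -!scalemxAr scalerA.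
- rewrite /Dz mulmx_sumr mulmx_suml; apply: eq_bigr => j _.
  rewrite adj_sum mulmx_sumr; apply: eq_bigr => k _.
  by rewrite adjZ -!scalemxAr -!scalemxAl scalerA mulrC.
Qed.

End Sandwich.
End PullMetric.

(** * Hermitian forms and degenerating inverses *)

Section Hermitian.
Context {R : realType} {n : nat}.
Implicit Types (A : 'M[R[i]]_n) (x y w : 'rV[R[i]]_n).

Lemma hnorm2E A x : hnorm2 A x = complex.Re ((x *m A *m x^H) 0 0).
Proof. by []. Qed.

Lemma realC_conj (r : R) : Num.conj (r%:C) = r%:C :> R[i].
Proof. by apply: complex_ext => /=; rewrite ?oppr0. Qed.

Lemma herm_val A x : A^H = A -> (x *m A *m x^H) 0 0 = (hnorm2 A x)%:C.
Proof.
move=> hA; set z := _ 0 0.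
have zr : Num.conj z = z.
  by rewrite /z -adjE !adjM adjK hA mulmxA.
apply: complex_ext => //=.
have := congr1 (@complex.Im R) zr; rewrite cImJ => /eqP.
by rewrite -subr_eq0 -opprD oppr_eq0 -mulr2n mulrn_eq0 /= => /eqP.
Qed.

Lemma herm_mx A x : A^H = A -> x *m A *m x^H = (hnorm2 A x)%:C%:M.
Proof.
by move=> hA; rewrite -herm_val// [LHS]mx11_scalar.
Qed.

Lemma posdef_unit A : posdef A -> A \in unitmx.
Proof.
move=> [hA pA]; rewrite -row_free_unit -kermx_eq0; apply/rowV0P => v /sub_kermxP vA.
apply/eqP; apply: contraT => /pA; rewrite hnorm2E vA mul0mx mxE /=.
by rewrite ltxx.
Qed.

Lemma hnorm2_line A x y (s : R) :
  hnorm2 A (x + s%:C *: y) = hnorm2 A x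
    + s * complex.Re ((x *m A *m y^H + y *m A *m x^H) 0 0) + s ^+ 2 * hnorm2 A y.
Proof.
rewrite !hnorm2E adjD adjZ realC_conj.
have -> : (x + s%:C *: y) *m A *m (x^H + s%:C *: y^H) =
   x *m A *m x^H + s%:C *: (x *m A *m y^H + y *m A *m x^H)
    + (s ^+ 2)%:C *: (y *m A *m y^H).
  rewrite mulmxDl mulmxDl !mulmxDr -!scalemxAl -!scalemxAr scalerA -rmorphM /=.
  by rewrite scalerDr -!addrA expr2.
rewrite 2!addmxE 2!scalemxE.
by rewrite 2!cReD 2!cReMr.
Qed.

Lemma hnorm2_scale A x (s : R) : hnorm2 A (s%:C *: x) = s ^+ 2 * hnorm2 A x.
Proof.
rewrite -[s%:C *: x]add0r hnorm2_line mul0mx adj0 mulmx0 addr0 !hnorm2E !mul0mx !mxE /=.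
by rewrite mulr0 !add0r.
Qed.

Lemma hnorm2_0 A : hnorm2 A 0 = 0.
Proof. by rewrite hnorm2E !mul0mx mxE. Qed.

Lemma hnorm2D_mx A A' x : hnorm2 (A + A') x = hnorm2 A x + hnorm2 A' x.
Proof. by rewrite !hnorm2E mulmxDr mulmxDl addmxE cReD. Qed.

Lemma hnorm2Z_mx A x (s : R) : hnorm2 (s%:C *: A) x = s * hnorm2 A x.
Proof. by rewrite !hnorm2E -scalemxAr -scalemxAl scalemxE cReMr. Qed.

(** For A positive definite, the squared A-distance to the line spanned by w
    ([hnorm2_defect]); up to a factor it is also the Fubini-Study form at w. *)
Definition defect A w : 'M[R[i]]_n :=
  A - ((hnorm2 A w)^-1)%:C *: (A *m w^H *m w *m A).

Section Defect.
Variables (A : 'M[R[i]]_n) (w : 'rV[R[i]]_n).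
Hypotheses (pA : posdef A) (w0 : w != 0).

Let hA : A^H = A. Proof. by case: pA. Qed.
Let k0 : 0 < hnorm2 A w. Proof. by case: pA => _; apply. Qed.

Lemma defect_herm : (defect A w)^H = defect A w.
Proof.
rewrite /defect adjD adjN adjZ realC_conj !adjM adjK hA.
by rewrite !mulmxA.
Qed.

Lemma w_defect : w *m defect A w = 0.
Proof.
rewrite /defect mulmxBr -scalemxAr !mulmxA (herm_mx _ hA).
rewrite mul_scalar_mx -scalemxAl scalerA -rmorphM /= mulVf ?gt_eqF//.
by rewrite scale1r subrr.
Qed.

Lemma defect_w : defect A w *m w^H = 0.
Proof. by rewrite -[LHS]adjK adjM adjK defect_herm w_defect adj0. Qed.

Lemma defect_add_line x (c : R[i]) :
  (c *: w + x) *m defect A w *m (c *: w + x)^H = x *m defect A w *m x^H.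
Proof.
rewrite mulmxDl -scalemxAl w_defect scaler0 add0r adjD adjZ mulmxDr -scalemxAr.
by rewrite -(mulmxA x (defect A w) (w^H)) defect_w mulmx0 scaler0 add0r.
Qed.

Lemma hnorm2_defect x : exists c : R[i],
  hnorm2 (defect A w) x = hnorm2 A (x - c *: w).
Proof.
pose c := (hnorm2 A w)^-1%:C * (x *m A *m w^H) 0 0; exists c.
have E : x = c *: w + (x - c *: w) by rewrite addrC subrK.
rewrite {1}E !hnorm2E defect_add_line; congr (complex.Re (_ 0 0)).
rewrite /defect mulmxBr mulmxBl -scalemxAr !mulmxA.
have -> : (x - c *: w) *m A *m w^H = 0.
  rewrite !mulmxBl -!scalemxAl (herm_mx _ hA) [x *m A *m _]mx11_scalar /c.
  rewrite scale_scalar_mx mulrAC -rmorphM mulVf ?gt_eqF// mul1r.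
  by rewrite subrr.
by rewrite !mul0mx scaler0 mul0mx subr0.
Qed.

Lemma defect_ge0 x : 0 <= hnorm2 (defect A w) x.
Proof.
have [c ->] := hnorm2_defect x.
have [->|nz] := eqVneq (x - c *: w) 0; first by rewrite hnorm2_0.
by apply/ltW; case: pA => _; apply.
Qed.

Lemma defect_gt0 x : (forall c, x != c *: w) -> 0 < hnorm2 (defect A w) x.
Proof.
move=> nx; have [c ->] := hnorm2_defect x.
by case: pA => _; apply; rewrite subr_eq0.
Qed.

End Defect.

End Hermitian.

Section InvTerm.
Context {R : realType} {n : nat}.
Variables (al : 'cV[R[i]]_n) (B : 'M[R[i]]_n) (k t : R) (e be : 'rV[R[i]]_n)
  (z : 'M[R[i]]_1).
Hypotheses (k0 : k != 0) (e_al : e *m al = 1%:M) (eB : e *m B = 0)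
  (hB : B^H = B) (be_e : be *m e^H = 0).
Let G := k%:C *: (al *m al^H) + t%:C *: B.
Let G1 := k%:C *: (al *m al^H) + B.
Hypotheses (uG : G \in unitmx) (uG1 : G1 \in unitmx).

(** The solution x of x G = z al^H + t be is (z / k) e + y, where y al = 0 and
    y B = be; such a y is found by solving the same equation at t = 1, and it
    does not depend on t.  This is why the inverse of G, of size 1 / t on the kernel
    of al, contributes only a bounded multiple of t. *)
Lemma degenerate_inverse_norm :
  (z *m al^H + t%:C *: be) *m invmx G *m (z *m al^H + t%:C *: be)^H =
  k^-1%:C *: (z *m z^H) + t%:C *: (be *m invmx G1 *m be^H).
Proof.
pose y := be *m invmx G1.
have kC : k%:C != 0 :> R[i] by rewrite (inj_eq (@complexI R)).
have yG : y *m G1 = be by rewrite /y -mulmxA mulVmx// mulmx1.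
have y_al : y *m al = 0.
  have Be : B *m e^H = 0 by rewrite -[LHS]adjK adjM adjK hB eB adj0.
  have ae : al^H *m e^H = 1%:M.
    by rewrite -adjM e_al; apply/matrixP => a b; rewrite adjE !mxE rmorph_nat eq_sym.
  have := congr1 (fun v => v *m e^H) yG.
  rewrite be_e /G1 mulmxDr mulmxDl -(mulmxA y B) Be mulmx0 addr0 -scalemxAr -scalemxAl.
  rewrite -!mulmxA ae mulmx1 => /eqP; rewrite scalemx_eq0 (negPf kC) /=.
  by move/eqP.
have yB : y *m B = be.
  by move: yG; rewrite /G1 mulmxDr -scalemxAr mulmxA y_al mul0mx scaler0 add0r.
rewrite -/y; clearbody y; pose x := k^-1%:C *: (z *m e) + y.
have xG : x *m G = z *m al^H + t%:C *: be.
  rewrite /x /G mulmxDl !mulmxDr -!scalemxAl -!scalemxAr -!mulmxA.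
  rewrite [e *m (al *m _)]mulmxA e_al mul1mx eB mulmx0 !scaler0 addr0.
  rewrite [y *m (al *m _)]mulmxA y_al mul0mx scaler0 add0r yB scalerA -rmorphM mulVf//.
  by rewrite scale1r.
rewrite -xG -[x *m G *m invmx G]mulmxA mulmxV// mulmx1 xG.
rewrite adjD adjM adjK adjZ realC_conj mulmxDr.
have -> : x *m (al *m z^H) = k^-1%:C *: (z *m z^H).
  rewrite mulmxA /x mulmxDl y_al addr0 -scalemxAl -[z *m e *m al]mulmxA e_al mulmx1.
  by rewrite scalemxAl.
congr (_ + _); rewrite -scalemxAr; congr (_ *: _).
rewrite /x mulmxDl -scalemxAl -mulmxA.
have -> : e *m be^H = 0 by rewrite -[LHS]adjK adjM adjK be_e adj0.
by rewrite mulmx0 scaler0 add0r.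
Qed.

End InvTerm.

Section Sign.
Context {R : realType} {n : nat}.
Variables (K K1 K2 : 'M[R[i]]_n) (w f z : 'rV[R[i]]_n).
Hypotheses (pK : posdef K) (w0 : w != 0) (nf : forall c, f != c *: w).

Let hK : K^H = K. Proof. by case: pK. Qed.
Let k := hnorm2 K w.
Let p := w *m K1 *m invmx K.
Let P := defect K w.

Let pKE : p *m K = w *m K1.
Proof. by rewrite /p -mulmxA mulVmx ?mulmx1//; exact: posdef_unit. Qed.

(** With p the covector of first derivatives of K in the direction w, raised by K,
    x + r p is a covariant derivative: K applied to it gives all terms that are
    quadratic in x or linear in K1, and the rank one inverse removes its component
    along w. *)
Lemma square_completion (x : 'rV[R[i]]_n) (r : R) :
  let v := (x *m K + r%:C *: (w *m K1)) *m w^H in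
  - (r%:C *: (x *m K1^H *m w^H) + (r ^+ 2)%:C *: (w *m K2 *m w^H)
     + x *m K *m x^H + r%:C *: (w *m K1 *m x^H)) + k^-1%:C *: (v *m v^H)
  = - ((x + r%:C *: p) *m P *m (x + r%:C *: p)^H)
    + (r ^+ 2)%:C *: (p *m K *m p^H - w *m K2 *m w^H).
Proof.
move=> v; set X := x + r%:C *: p.
have XK : x *m K + r%:C *: (w *m K1) = X *m K.
  by rewrite /X mulmxDl -scalemxAl pKE.
have -> : k^-1%:C *: (v *m v^H) = X *m K *m X^H - X *m P *m X^H.
  rewrite /P /defect mulmxBr mulmxBl opprB addrC subrK -scalemxAr -scalemxAl.
  by congr (_ *: _); rewrite /v XK adjM adjK adjM hK !mulmxA.
have Kp : K *m p^H = K1^H *m w^H by rewrite -{1}hK -adjM pKE adjM.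
have -> : X *m K *m X^H = x *m K *m x^H + r%:C *: (x *m K1^H *m w^H)
   + r%:C *: (w *m K1 *m x^H) + (r ^+ 2)%:C *: (p *m K *m p^H).
  rewrite /X adjD adjZ realC_conj mulmxDl mulmxDl !mulmxDr -!scalemxAl -!scalemxAr.
  rewrite scalerA -rmorphM -expr2 -(mulmxA x K (p^H)) Kp pKE !mulmxA -!addrA.
  by [].
rewrite scalerBr.
move: (x *m K *m _) (r%:C *: (x *m _ *m _)) (r%:C *: (w *m _ *m _)) (X *m P *m _)
  (_ *: (p *m K *m _)) (_ *: (w *m K2 *m _)) => a b c d e g.
rewrite !opprD; apply/eqP; rewrite -subr_eq0; apply/eqP.
move: a b c d e g; clear => a b c d e g.
apply/matrixP => i j; rewrite !mxE; ring.
Qed.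

(** The multiple of w does not contribute, and the defect form of s f + s^2 (z + p)
    is s^2 times a quadratic polynomial in s with positive value at 0, which
    outweighs the s^4 term for small s. *)
Lemma degenerate_curvature_lt0 : exists2 s : R, 0 < s &
  forall (x : 'rV[R[i]]_n) (v : 'M[R[i]]_1) (c : R[i]),
   x = c *: w + (s%:C *: f + (s ^+ 2)%:C *: z) ->
   v = (x *m K + (s ^+ 2)%:C *: (w *m K1)) *m w^H ->
   complex.Re ((- ((s ^+ 2)%:C *: (x *m K1^H *m w^H) + (s ^+ 2 ^+ 2)%:C *: (w *m K2 *m w^H)
     + x *m K *m x^H + (s ^+ 2)%:C *: (w *m K1 *m x^H)) + k^-1%:C *: (v *m v^H)) 0 0) < 0.
Proof.
pose b := complex.Re ((f *m P *m (z + p)^H + (z + p) *m P *m f^H) 0 0).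
pose d := hnorm2 P (z + p).
pose q := complex.Re ((p *m K *m p^H - w *m K2 *m w^H) 0 0).
pose a := hnorm2 P f.
have a0 : 0 < a by exact: defect_gt0.
(* For s <= 1, s b + s^2 d - s^2 q is at least - s T > - a. *)
pose T := `|b| + `|d| + `|q|.
have T0 : 0 <= T by rewrite !addr_ge0.
pose s := a / (a + T).
have aT : 0 < a + T by rewrite ltr_wpDr.
have s0 : 0 < s by rewrite divr_gt0.
have s1 : s <= 1 by rewrite ler_pdivrMr// mul1r lerDl.
exists s; first exact: s0.
move=> x v c xE ->; rewrite square_completion xE.
rewrite addmxE scalemxE oppmxE cReD cReMr -/q.
have -> : c *: w + (s%:C *: f + (s ^+ 2)%:C *: z) + (s ^+ 2)%:C *: p =
   c *: w + s%:C *: (f + s%:C *: (z + p)).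
  by rewrite -!addrA; congr (_ + _); rewrite !scalerDr !scalerA -rmorphM -expr2.
rewrite defect_add_line//.
have -> y : complex.Re (- ((y *m P *m y^H) 0 0)) = - hnorm2 P y.
  by rewrite hnorm2E; case: (_ 0 0).
rewrite hnorm2_scale hnorm2_line -/a -/b -/d.
have -> : - (s ^+ 2 * (a + s * b + s ^+ 2 * d)) + s ^+ 2 ^+ 2 * q =
   s ^+ 2 * (- (a + s * b + s ^+ 2 * d) + s ^+ 2 * q) by ring.
rewrite pmulr_rlt0 ?exprn_gt0//.
have sT : s * T < a.
  by rewrite /s mulrAC ltr_pdivrMr// ltr_pM2l// -[ltLHS]add0r ltrD2r.
have hb : - (s * b) <= s * `|b| by rewrite -mulrN ler_pM2l// -normrN ler_norm.
have ss : s ^+ 2 <= s by rewrite expr2 ger_pMl.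
have hd : - (s ^+ 2 * d) <= s * `|d|.
  rewrite -mulrN; apply: (@le_trans _ _ (s ^+ 2 * `|d|)).
    by rewrite ler_pM2l ?exprn_gt0// -normrN ler_norm.
  by rewrite ler_wpM2r.
have hq : s ^+ 2 * q <= s * `|q|.
  apply: (@le_trans _ _ (s ^+ 2 * `|q|)).
    by rewrite ler_pM2l ?exprn_gt0// ler_norm.
  by rewrite ler_wpM2r.
move: sT; rewrite /T !mulrDr; lra.
Qed.

End Sign.

(** * Curvature of a pulled-back metric with a small perturbation *)

Section SmoothMul.
Context {R : realType} {n : nat}.
Implicit Types (U : set (Cn R n)) (f g : Cn R n -> R) (F G : Cn R n -> R[i]).

Lemma CkW k U f : Ck k.+1 U f -> Ck k U f.
Proof.
elim: k f => [|k IH] f [df cf].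
  by move=> u Uu; exact: differentiable_continuous (df u Uu).
by split=> [//|v]; exact/IH/cf.
Qed.

Lemma CkM k U f g : open U -> Ck k U f -> Ck k U g -> Ck k U (fun w => f w * g w).
Proof.
move=> oU; elim: k f g => [|k IH] f g.
  by move=> cf cg u Uu; apply: cvgM; [exact: cf|exact: cg].
move=> cf cg; have cf' := CkW cf; have cg' := CkW cg.
case: cf cg => [df cf] [dg cg]; split=> [u Uu|v].
  by apply: differentiableM; [exact: df|exact: dg].
apply: (Ck_ext oU _ (CkD oU (IH _ _ cf' (cg v)) (IH _ _ cg' (cf v)))) => u Uu.
have /diff_derivable e1 := df u Uu; have /diff_derivable e2 := dg u Uu.
by rewrite (deriveM (e1 v) (e2 v)).
Qed.

Lemma csmoothM U F G : open U -> csmooth U F -> csmooth U G ->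
  csmooth U (fun w => F w * G w).
Proof.
move=> oU [a b] [c d]; split=> k.
  under eq_fun do rewrite cReM -mulN1r.
  apply: CkD => //; first exact: CkM.
  by apply: CkZ => //; exact: CkM.
under eq_fun do rewrite cImM.
by apply: CkD => //; exact: CkM.
Qed.

Lemma holM U F G : open U -> hol U F -> hol U G -> hol U (fun w => F w * G w).
Proof.
move=> oU [sF hF] [sG hG]; split=> [|u Uu j]; first exact: csmoothM.
rewrite (dzbM _ (csmooth_diff sF Uu) (csmooth_diff sG Uu)).
by rewrite hF// hG// mul0r mulr0 addr0.
Qed.

Lemma hol_cst U (c : R[i]) : hol U (fun=> c).
Proof. by split=> [|u _ j]; [exact: csmooth_cst|rewrite dzb_cst]. Qed.

End SmoothMul.

Lemma quad_expand (R : realType) n (xi : 'rV[R[i]]_n) (M1 M K L L' L2 T : 'M[R[i]]_n) (t : R[i]) :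
  xi *m (M1 *m L' *m M^H + M *m L2 *m M^H + (M1 *m K *m M1^H + M *m L *m M1^H) + t *: T)
    *m xi^H =
  xi *m M1 *m L' *m (xi *m M)^H + xi *m M *m L2 *m (xi *m M)^H
  + xi *m M1 *m K *m (xi *m M1)^H + xi *m M *m L *m (xi *m M1)^H
  + t *: (xi *m T *m xi^H).
Proof.
rewrite !(adjM xi) !mulmxA !mulmxDr !mulmxDl -!scalemxAr -!scalemxAl !mulmxA.
by rewrite !addrA.
Qed.

Lemma curvature_shape (R : realType) n (xi c : 'rV[R[i]]_n) (A N I Nb : 'M[R[i]]_n)
    (b d : 'M[R[i]]_1) :
  xi *m N = c -> Nb *m xi^H = c^H -> xi *m A *m xi^H = b + d ->
  xi *m (- A + N *m I *m Nb) *m xi^H = - b + c *m I *m c^H - d.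
Proof.
move=> cE cE' D.
rewrite mulmxDr mulmxDl mulmxN mulNmx D -cE' -cE !mulmxA.
by rewrite opprD addrAC.
Qed.

Section TwoTerms.
Context {R : realType} {n : nat}.
Variables (U : set (Cn R n)) (M K B : Cn R n -> 'M[R[i]]_n) (u : Cn R n)
  (xi : 'rV[R[i]]_n) (t : R) (G : Cn R n -> 'M[R[i]]_n).
Hypotheses (oU : open U) (Uu : U u) (hM : mhol U M)
  (dK : forall w, U w -> mdiff K w) (ddK : forall k, mdiff (mdzb k K) u)
  (hK : forall w, U w -> (K w)^H = K w) (sB : msmooth U B)
  (hB : forall w, U w -> (B w)^H = B w)
  (GE : \forall w \near u, G w = M w *m K w *m (M w)^H + t%:C *: B w).

Let P w := M w *m K w *m (M w)^H.
Let dP w : U w -> mdiff P w. Proof. exact: sandwich_mdiff. Qed.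
Let dB w : U w -> mdiff B w. Proof. exact: msmooth_mdiff. Qed.
Let dtB w : U w -> mdiff (fun w => t%:C *: B w) w.
Proof. by move=> Uw; exact/mdiffZ/dB. Qed.

Let DzG : Dz xi G u = Dz xi P u + t%:C *: Dz xi B u.
Proof.
rewrite /Dz scaler_sumr -big_split; apply: eq_bigr => j _ /=.
rewrite (mdz_near _ GE) (mdzD _ (dP Uu) (dtB Uu)) (mdzZ _ _ (dB Uu)).
by rewrite scalerDr !scalerA mulrC.
Qed.

Let dmB k : mdiff (mdzb k B) u.
Proof. exact: msmooth_mdiff (msmooth_mdzb k oU sB) Uu. Qed.

Let DDbG : DDb xi G u = DDb xi P u + t%:C *: DDb xi B u.
Proof.
rewrite /DDb scaler_sumr -big_split; apply: eq_bigr => j _ /=.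
rewrite scaler_sumr -big_split; apply: eq_bigr => k _ /=.
have E : \forall w \near u, mdzb k G w = mdzb k P w + t%:C *: mdzb k B w.
  have : \forall w \near u, U w by exact: open_nbhs_nbhs.
  have : \forall w \near u, \forall w' \near w, G w' = P w' + t%:C *: B w'.
    exact: nbhs_interior GE.
  apply: filterS2 => w Gw Uw.
  by rewrite (mdzb_near _ Gw) (mdzbD _ (dP Uw) (dtB Uw)) (mdzbZ _ _ (dB Uw)).
rewrite (mdz_near _ E) (mdzD _ _ (mdiffZ _ (dmB k))); last first.
  exact: (mdiff_mdzb_sandwich oU hM Uu dK ddK k).
by rewrite (mdzZ _ _ (dmB k)) scalerDr !scalerA (mulrC _ t%:C).
Qed.

Let DzbG : Dzb xi G u = (Dz xi G u)^H.
Proof.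
apply: Dzb_adj.
  have UU : \forall w \near u, U w by exact: open_nbhs_nbhs.
  apply: filterS2 UU GE => w Uw ->.
  by rewrite adjD adjZ realC_conj hB// !adjM adjK hK// mulmxA.
apply: (@mdiff_near _ _ _ _ (fun w => P w + t%:C *: B w)).
  by apply: filterS GE => w ->.
by apply: mdiffD; [exact: dP|exact: dtB].
Qed.

(** The product rule leaves four terms of the mixed derivative of M K M^H, and since
    G is Hermitian its two first derivatives enter through the single covector c
    and its adjoint. *)
Lemma curvature_two_terms (x1 eta c : 'rV[R[i]]_n) (L L2 Gu : 'M[R[i]]_n) :
  xi *m Dz xi M u = x1 -> xi *m M u = eta -> Dz xi K u = L -> DDb xi K u = L2 ->
  G u = Gu -> (x1 *m K u + eta *m L) *m (M u)^H + t%:C *: (xi *m Dz xi B u) = c ->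
  curvature4 G u xi xi xi xi =
  (- (x1 *m L^H *m eta^H + eta *m L2 *m eta^H + x1 *m K u *m x1^H
      + eta *m L *m x1^H) + c *m invmx Gu *m c^H
   - t%:C *: (xi *m DDb xi B u *m xi^H)) 0 0.
Proof.
move=> <- <- <- <- <- <-; rewrite curvature4E; congr (fun_of_matrix _ 0 0).
have cE : xi *m Dz xi G u = (xi *m Dz xi M u *m K u + xi *m M u *m Dz xi K u) *m (M u)^H
    + t%:C *: (xi *m Dz xi B u).
  rewrite DzG (Dz_sandwich xi hM Uu dK) mulmxDr mulmxDr mulmxDl -scalemxAr.
  by rewrite !mulmxA.
have cE' := congr1 (@adj _ _ _) cE; rewrite adjM -DzbG in cE'.
have LH : Dzb xi K u = (Dz xi K u)^H.
  apply: Dzb_adj (dK Uu); exact: open_near oU Uu hK.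
have D1 := DDb_sandwich xi oU hM Uu dK ddK.
have D2 := etrans DDbG (congr1 (fun A => A + t%:C *: DDb xi B u) D1).
have D3 := congr1 (fun A => xi *m A *m xi^H) D2.
rewrite LH quad_expand in D3.
exact: (curvature_shape (invmx (G u)) cE cE' D3).
Qed.

End TwoTerms.

Section CnInverse.
Context {R : realType} {n : nat}.

Definition cnvec (w : 'rV[R[i]]_n) : Cn R n :=
  (\row_j complex.Re (w 0 j), \row_j complex.Im (w 0 j)).

Lemma cnvecK w : zvec (cnvec w) = w.
Proof.
by apply/rowP => j; rewrite !mxE; apply: complex_ext.
Qed.

Lemma zvecK (v : Cn R n) : cnvec (zvec v) = v.
Proof. by case: v => x y; congr pair; apply/rowP => j; rewrite !mxE. Qed.

End CnInverse.

Section FubiniStudy.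
Context {R : realType} {n : nat}.
Variable Q : 'M[R[i]]_n.
Hypothesis pQ : posdef Q.

Definition FS (w : 'rV[R[i]]_n) : 'M[R[i]]_n := ((hnorm2 Q w)^-1)%:C *: defect Q w.

Lemma FS_herm w : (FS w)^H = FS w.
Proof. by rewrite /FS adjZ realC_conj defect_herm//; case: pQ. Qed.

Lemma FS_ge0 w x : w != 0 -> 0 <= hnorm2 (FS w) x.
Proof.
move=> w0; rewrite hnorm2Z_mx mulr_ge0 ?defect_ge0//.
by rewrite invr_ge0 ltW//; case: pQ => _; apply.
Qed.

Lemma FS_gt0 w x : w != 0 -> (forall c, x != c *: w) -> 0 < hnorm2 (FS w) x.
Proof.
move=> w0 nx; rewrite hnorm2Z_mx mulr_gt0 ?defect_gt0//.
by rewrite invr_gt0; case: pQ => _; apply.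
Qed.

Lemma mdiff_cst {l p q} (A : 'M[R[i]]_(p, q)) (u : Cn R l) : mdiff (fun=> A) u.
Proof. by move=> a b; exact: cdiff_cst. Qed.

Lemma hnorm2_differentiable {l} (f : Cn R l -> 'rV[R[i]]_n) u :
  mdiff f u -> differentiable (fun w => hnorm2 Q (f w)) u.
Proof.
move=> df.
have : mdiff (fun w => f w *m Q *m (f w)^H) u.
  exact: mdiffM (mdiffM df (mdiff_cst Q u)) (mdiff_adj df).
by move=> /(_ 0 0)[].
Qed.

Lemma FS_mdiff {l} (f : Cn R l -> 'rV[R[i]]_n) u :
  mdiff f u -> f u != 0 -> mdiff (fun w => FS (f w)) u.
Proof.
move=> df f0; have N0 : hnorm2 Q (f u) != 0 by rewrite gt_eqF//; case: pQ => _; apply.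
have dN := hnorm2_differentiable df.
have di : cdiff (fun w => ((hnorm2 Q (f w))^-1)%:C) u.
  by apply: cdiff_real; exact: differentiableV.
have dA : mdiff (fun w => Q *m (f w)^H *m f w *m Q) u.
  apply: mdiffM (mdiff_cst Q u); apply: mdiffM (df).
  exact: mdiffM (mdiff_cst Q u) (mdiff_adj df).
move=> a b.
have -> : (fun w => FS (f w) a b) = (fun w => ((hnorm2 Q (f w))^-1)%:C *
   (Q a b + -1 * (((hnorm2 Q (f w))^-1)%:C * (Q *m (f w)^H *m f w *m Q) a b))).
  by apply/funext => w; rewrite scalemxE addmxE oppmxE scalemxE mulN1r.
apply: cdiffM (di) _; apply: cdiffD; first exact: cdiff_cst.
exact: cdiffZ (cdiffM di (dA a b)).
Qed.

End FubiniStudy.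

(** * The blowup in coordinates *)

Section DzRules.
Context {R : realType} {n : nat}.
Implicit Types (u : Cn R n) (x : 'rV[R[i]]_n).

Lemma Dz_near {p q} x (F F' : Cn R n -> 'M[R[i]]_(p, q)) u :
  (\forall w \near u, F w = F' w) -> Dz x F u = Dz x F' u.
Proof. by move=> E; apply: eq_bigr => j _; rewrite (mdz_near j E). Qed.

Lemma DzM {p q r} x (F : Cn R n -> 'M[R[i]]_(p, q)) (F' : Cn R n -> 'M[R[i]]_(q, r)) u :
  mdiff F u -> mdiff F' u ->
  Dz x (fun w => F w *m F' w) u = Dz x F u *m F' u + F u *m Dz x F' u.
Proof.
move=> dF dF'; rewrite /Dz mulmx_suml mulmx_sumr -big_split; apply: eq_bigr => j _ /=.
by rewrite (mdzM _ dF dF') scalerDr -scalemxAl -scalemxAr.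
Qed.

Lemma Dz_add {p q} x (F F' : Cn R n -> 'M[R[i]]_(p, q)) u :
  mdiff F u -> mdiff F' u ->
  Dz x (fun w => F w + F' w) u = Dz x F u + Dz x F' u.
Proof.
move=> dF dF'; rewrite /Dz -big_split; apply: eq_bigr => j _ /=.
by rewrite (mdzD _ dF dF') scalerDr.
Qed.

Lemma mdiff_scalef {p q} (f : Cn R n -> R[i]) (F : Cn R n -> 'M[R[i]]_(p, q)) u :
  cdiff f u -> mdiff F u -> mdiff (fun w => f w *: F w) u.
Proof.
by move=> df dF a b; under eq_fun do rewrite scalemxE; exact: cdiffM.
Qed.

Lemma Dz_scalef {p q} x (f : Cn R n -> R[i]) (F : Cn R n -> 'M[R[i]]_(p, q)) u :
  cdiff f u -> mdiff F u -> f u = 0 ->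
  Dz x (fun w => f w *: F w) u = (\sum_j x 0 j * dz j f u) *: F u.
Proof.
move=> df dF f0; rewrite /Dz scaler_suml; apply: eq_bigr => j _.
rewrite -scalerA; congr (_ *: _); apply/matrixP => a b.
rewrite mxE scalemxE; under eq_fun do rewrite scalemxE.
by rewrite (dzM _ df (dF a b)) f0 mul0r addr0.
Qed.

Lemma Dz_zvec {m} x (s : Cn R n -> Cn R m) u : Dz x (fun w => zvec (s w)) u = x *m jac s u.
Proof.
apply/rowP => a; rewrite /Dz summxE [RHS]mxE; apply: eq_bigr => j _.
by rewrite scalemxE [mdz _ _ _ _ _]mxE [jac _ _ _ _]mxE.
Qed.

(** Second derivatives of m in the directions x and x', hence symmetric. *)
Lemma Dz_jac_sym U (m : Cn R n -> Cn R n) u x x' :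
  open U -> U u -> (forall a, hol U (fun w => zvec (m w) 0 a)) ->
  x' *m Dz x (jac m) u = x *m Dz x' (jac m) u.
Proof.
move=> oU Uu hm.
have E (z z' : 'rV[R[i]]_n) : z' *m Dz z (jac m) u =
   \row_c \sum_k \sum_j z' 0 k * (z 0 j * dz j (dz k (fun w => zvec (m w) 0 c)) u).
  apply/rowP => c; rewrite [LHS]mxE [RHS]mxE; apply: eq_bigr => k _.
  rewrite /Dz summxE mulr_sumr; apply: eq_bigr => j _.
  rewrite scalemxE [mdz _ _ _ _ _]mxE.
  by under eq_fun do rewrite mxE.
rewrite !E; apply/rowP => c; rewrite [LHS]mxE [RHS]mxE exchange_big /=.
apply: eq_bigr => k _; apply: eq_bigr => j _.
have [sm _] := hm c.
by rewrite (dz_dz _ _ oU sm Uu) mulrCA.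
Qed.

Lemma Dz_cst {p q} x (A : 'M[R[i]]_(p, q)) u : Dz x (fun=> A) u = 0.
Proof.
by apply: big1 => j _; apply/matrixP => a b; rewrite scalemxE mxE dz_cst mulr0 mxE.
Qed.

Lemma Dz_adj0 {p q} x (F : Cn R n -> 'M[R[i]]_(p, q)) u : mdiff F u ->
  (forall j, mdzb j F u = 0) -> Dz x (fun w => (F w)^H) u = 0.
Proof.
by move=> dF F0; apply: big1 => j _; rewrite (mdz_adj _ dF) F0 adj0 scaler0.
Qed.

(** A factor that vanishes at u contributes only its own derivative, and the
    adjoint of a holomorphic factor has none in the direction x. *)
Lemma Dz_mul_adj0 {p q r} x (F : Cn R n -> 'M[R[i]]_(p, q))
    (F' : Cn R n -> 'M[R[i]]_(r, q)) u :
  mdiff F u -> mdiff F' u -> F' u = 0 -> (forall j, mdzb j F' u = 0) ->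
  Dz x (fun w => F w *m (F' w)^H) u = 0.
Proof.
move=> dF dF' F0 DF0; rewrite (DzM x dF (mdiff_adj dF')) (Dz_adj0 x dF' DF0) F0.
by rewrite adj0 !mulmx0 addr0.
Qed.

Lemma mdzb_cstM {p q r} (A : 'M[R[i]]_(p, q)) (F : Cn R n -> 'M[R[i]]_(q, r)) j u :
  mdiff F u -> mdzb j (fun w => A *m F w) u = A *m mdzb j F u.
Proof.
move=> dF; rewrite (mdzbM _ (mdiff_cst A u) dF).
have -> : mdzb j (fun=> A) u = 0 by apply/matrixP => a b; rewrite !mxE dzb_cst.
by rewrite mul0mx add0r.
Qed.

Lemma small_perturbation (E D t : R) : 0 < t -> t < - E / (`|D| + 1) -> E + t * D < 0.
Proof.
move=> tpos; rewrite ltr_pdivlMr ?ltr_wpDl// mulrDr mulr1.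
have : t * D <= t * `|D| by rewrite ler_pM2l// ler_norm.
move: (t * D) (t * `|D|) => p q; lra.
Qed.

Lemma rank_one_sandwich (a : 'cV[R[i]]_n) (w : 'rV[R[i]]_n) (K : 'M[R[i]]_n) :
  K^H = K -> (a *m w) *m K *m (a *m w)^H = (hnorm2 K w)%:C *: (a *m a^H).
Proof.
move=> hK; transitivity (a *m (w *m K *m w^H) *m a^H); first by rewrite adjM !mulmxA.
by rewrite (herm_mx _ hK) mul_mx_scalar -scalemxAl.
Qed.

Lemma final_algebra (x w : 'rV[R[i]]_n) (K K1 K2 : 'M[R[i]]_n) (N P S : 'M[R[i]]_1) (r t : R) :
  - (x *m (r%:C *: K1)^H *m (r%:C *: w)^H + r%:C *: w *m ((r ^+ 2)%:C *: K2) *m (r%:C *: w)^H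
     + x *m K *m x^H + r%:C *: w *m (r%:C *: K1) *m x^H)
  + (N + t%:C *: P) - t%:C *: S =
  (- ((r ^+ 2)%:C *: (x *m K1^H *m w^H) + (r ^+ 2 ^+ 2)%:C *: (w *m K2 *m w^H)
     + x *m K *m x^H + (r ^+ 2)%:C *: (w *m K1 *m x^H)) + N) + t%:C *: (P - S).
Proof.
rewrite !adjZ !realC_conj -!scalemxAl -!scalemxAr -!scalemxAl !scalerA -!rmorphM.
have -> : r * (r * r ^+ 2) = r ^+ 2 ^+ 2 by ring.
by rewrite scalerBr -!expr2 !addrA.
Qed.

End DzRules.

Opaque Dz Dzb DDb mdz mdzb hnorm2 FS.


Section Model.
Context {R : realType} {n : nat}.
Variables (Q : 'M[R[i]]_n) (i j0 : 'I_n) (U V0 V : set (Cn R n)) (u0 : Cn R n)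
  (y m T : Cn R n -> Cn R n) (H B : Cn R n -> 'M[R[i]]_n).

Let Y w := zvec (y w).
Let ww w := aff_gen i (Y w).
Let g w := cnvec (Y w 0 i *: ww w).
Let s w := cnvec (ww w).
Let M := jac m.
Let W := jac s.
Let J := jac y u0.
Let A := jac T (g u0).

Hypotheses (pQ : posdef Q) (ij : j0 != i)
  (oU : open U) (Uu0 : U u0) (hy : forall a, hol U (fun w => Y w 0 a))
  (hm : forall a, hol U (fun w => zvec (m w) 0 a))
  (oV0 : open V0) (hT : forall a, hol V0 (fun v => zvec (T v) 0 a))
  (gV : forall w, U w -> V0 (g w)) (mE : forall w, U w -> m w = T (g w))
  (uJ : J \in unitmx) (Y0 : Y u0 0 i = 0) (uA : A \in unitmx)
  (oV : open V) (UV : forall w, U w -> V (m w)) (sH : msmooth V H)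
  (hH : forall v, V v -> (H v)^H = H v) (pH : posdef (H (m u0)))
  (sB : msmooth U B) (BE : forall w, U w -> B w = W w *m FS Q (ww w) *m (W w)^H).

Let wwE w a : ww w 0 a = if a == i then 1 else Y w 0 a.
Proof. by rewrite /ww /aff_gen mxE. Qed.

Let ww_i w : ww w 0 i = 1. Proof. by rewrite wwE eqxx. Qed.

Let ww_neq0 w : ww w != 0.
Proof.
by apply/eqP => /rowP/(_ i); rewrite ww_i mxE => /eqP; rewrite oner_eq0.
Qed.

Let hww a : hol U (fun w => ww w 0 a).
Proof.
have [->|ai] := eqVneq a i.
  have -> : (fun w => ww w 0 i) = (fun=> 1) by apply/funext => w; rewrite ww_i.
  exact: hol_cst.
have -> : (fun w => ww w 0 a) = (fun w => Y w 0 a).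
  by apply/funext => w; rewrite wwE (negPf ai).
exact: hy.
Qed.

Let hs a : hol U (fun w => zvec (s w) 0 a).
Proof. by under eq_fun do rewrite /s cnvecK; exact: hww. Qed.

Let hg a : hol U (fun w => zvec (g w) 0 a).
Proof. by under eq_fun do rewrite /g cnvecK scalemxE; exact: holM. Qed.

Let al w : 'cV[R[i]]_n := \col_k dz k (fun w => Y w 0 i) w.

(** The Leibniz rule for the blowdown y_i w. *)
Let jac_g w : U w -> jac g w = al w *m ww w + Y w 0 i *: W w.
Proof.
move=> Uw; apply/matrixP => k a; rewrite mxE addmxE scalemxE.
have -> : (al w *m ww w) k a = al w k 0 * ww w 0 a by rewrite mxE big_ord1.
rewrite [al w k 0]mxE [W w k a]mxE.
under eq_fun do rewrite /g cnvecK scalemxE.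
under [X in _ = _ + _ * dz _ X _]eq_fun do rewrite /s cnvecK.
rewrite dzM//; first by have [c _] := hy i; exact: csmooth_diff c Uw.
by have [c _] := hww a; exact: csmooth_diff c Uw.
Qed.

Let M_E w : U w -> M w = jac g w *m jac T (g w).
Proof.
move=> Uw; apply/matrixP => k c; rewrite [LHS]mxE [RHS]mxE.
have E : \forall w' \near w, zvec (m w') 0 c = zvec (T (g w')) 0 c.
  by apply: (open_near oU Uw) => w' Uw'; rewrite mE.
have [sT _] := hT c.
rewrite (dz_near _ E) (dz_comp _ (hol_vdiff hg Uw) (csmooth_diff sT (gV Uw))).
apply: eq_bigr => a _; have [_ ->] := hg a => //.
by rewrite conjC0 mulr0 addr0 mulrC [jac g w k a]mxE [jac T _ a c]mxE.
Qed.

Let a0 := al u0.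
Let w0 := ww u0.
Let wh := w0 *m A.

Let M0 : M u0 = a0 *m wh.
Proof. by rewrite (M_E Uu0) (jac_g Uu0) Y0 scale0r addr0 mulmxA. Qed.

Let al_diff : mdiff al u0.
Proof.
move=> k c; under eq_fun do rewrite mxE.
have [sY _] := hy i; exact: csmooth_diff (csmooth_dz k oU sY) Uu0.
Qed.

Let ww_diff w : U w -> mdiff ww w.
Proof. by move=> Uw k c; rewrite ord1; have [sw _] := hww c; exact: csmooth_diff sw Uw. Qed.

Let W_hol : mhol U W. Proof. exact: jac_mhol oU hs. Qed.
Let W_diff : mdiff W u0. Proof. exact: msmooth_mdiff (mhol_msmooth W_hol) Uu0. Qed.

Let Y_diff : cdiff (fun w => Y w 0 i) u0.
Proof. by have [sY _] := hy i; exact: csmooth_diff sY Uu0. Qed.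

Let A_hol : mhol V0 (jac T). Proof. exact: jac_mhol oV0 hT. Qed.
Let A_diff : mdiff (jac T) (g u0).
Proof. exact: msmooth_mdiff (mhol_msmooth A_hol) (gV Uu0). Qed.

Let Dz_ww (x : 'rV[R[i]]_n) : Dz x ww u0 = x *m W u0.
Proof.
have E : (fun w => zvec (s w)) = ww by apply/funext => w; exact: cnvecK.
exact: etrans (congr1 (fun F => Dz x F u0) (esym E)) (Dz_zvec x s u0).
Qed.

Let x_al (x : 'rV[R[i]]_n) : \sum_j x 0 j * dz j (fun w => Y w 0 i) u0 = (x *m a0) 0 0.
Proof. by rewrite [RHS]mxE; apply: eq_bigr => j _; rewrite [a0 j 0]mxE. Qed.

(** At a point of E, where y_i = 0, second derivatives of w do not enter. *)
Let DzM_E (x : 'rV[R[i]]_n) : Dz x M u0 =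
  (Dz x al u0 *m w0 + a0 *m (x *m W u0) + (x *m a0) 0 0 *: W u0) *m A
  + a0 *m w0 *m Dz (x *m a0 *m w0) (jac T) (g u0).
Proof.
have jg : mdiff (jac g) u0.
  exact: msmooth_mdiff (mhol_msmooth (jac_mhol oU hg)) Uu0.
have jT : mdiff (fun w => jac T (g w)) u0 by exact: mdiff_pull hg _ _ _ _ Uu0 A_diff.
have jg0 : jac g u0 = a0 *m w0 by rewrite (jac_g Uu0) Y0 scale0r addr0.
rewrite (Dz_near x (open_near oU Uu0 M_E)) (DzM x jg jT) (Dz_pull hg x Uu0 A_diff).
rewrite jg0 mulmxA; congr (_ *m _ + _).
rewrite (Dz_near x (open_near oU Uu0 jac_g)).
rewrite Dz_add; [|exact: mdiffM (ww_diff Uu0)|exact: mdiff_scalef].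
rewrite (DzM x al_diff (ww_diff Uu0)) (Dz_scalef x Y_diff W_diff Y0).
by rewrite Dz_ww x_al.
Qed.

Let col_W (x : 'rV[R[i]]_n) (a : 'I_n) : (x *m W u0) 0 a = if a == i then 0 else (x *m J) 0 a.
Proof.
rewrite [LHS]mxE; have [->|ai] := eqVneq a i.
  apply: big1 => k _; rewrite [W u0 k i]mxE.
  under eq_fun do rewrite /s cnvecK ww_i.
  by rewrite dz_cst mulr0.
rewrite [RHS]mxE; apply: eq_bigr => k _; rewrite [W u0 k a]mxE [J k a]mxE.
by under eq_fun do rewrite /s cnvecK wwE (negPf ai).
Qed.

Let x_a0 (x : 'rV[R[i]]_n) : x *m a0 = ((x *m J) 0 i)%:M.
Proof.
rewrite [LHS]mx11_scalar; congr (_%:M); rewrite [LHS]mxE [RHS]mxE.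
by apply: eq_bigr => k _; rewrite [a0 k 0]mxE [J k i]mxE.
Qed.

Let e := row i (invmx J).
Let x0 := row j0 (invmx J).

Let rowJ k a : (row k (invmx J) *m J) 0 a = (k == a)%:R.
Proof. by rewrite -row_mul (mulVmx uJ) [LHS]mxE [LHS]mxE. Qed.

Let e_a0 : e *m a0 = 1%:M.
Proof. by rewrite x_a0 rowJ eqxx. Qed.
Let x0_a0 : x0 *m a0 = 0.
Proof. by rewrite x_a0 rowJ (negPf ij) raddf0. Qed.
Let e_W : e *m W u0 = 0.
Proof.
by apply/rowP => a; rewrite col_W rowJ mxE; case: (eqVneq a i) => // ai; rewrite eq_sym (negPf ai).
Qed.
Let fh := x0 *m W u0 *m A.

(** The i-th entry of w is 1 while that of dw vanishes. *)
Let f_indep c : 2 *: fh != c *: wh.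
Proof.
apply/eqP => E.
have : 2 *: (x0 *m W u0) = c *: w0.
  apply: (can_inj (mulmxK uA)); rewrite -!scalemxAl.
  by rewrite -/fh -/wh.
move=> /rowP E'.
have := E' i; rewrite !scalemxE col_W eqxx mulr0 /w0 ww_i mulr1 => c0.
have := E' j0; rewrite !scalemxE -c0 mul0r col_W (negPf ij) rowJ eqxx mulr1 => /eqP.
by rewrite pnatr_eq0.
Qed.

(** A direction x tangent to E kills every derivative of y_i, so up to multiples of
    the image of w only the mixed term dy_i(x') dw(x) is left. *)
Let hess_gen (x' x : 'rV[R[i]]_n) : x *m a0 = 0 ->
  x' *m Dz x M u0 = (x' *m Dz x al u0) 0 0 *: wh + (x' *m a0) 0 0 *: (x *m W u0 *m A).
Proof.
move=> xa0; have Z : (x *m a0) 0 0 = 0 by rewrite xa0 mxE.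
have D0 : Dz (x *m a0 *m w0) (jac T) (g u0) = 0.
  by rewrite xa0 mul0mx -(scale0r (0 : 'rV[R[i]]_n)) DzZ scale0r.
rewrite DzM_E Z D0 scale0r addr0 mulmx0 addr0 mulmxDl mulmxDr.
rewrite -!mul_scalar_mx -!mx11_scalar /wh.
by rewrite !mulmxA.
Qed.

Let hess_x0x0 : x0 *m Dz x0 M u0 = (x0 *m Dz x0 al u0) 0 0 *: wh.
Proof.
have Z : (x0 *m a0) 0 0 = 0 by rewrite x0_a0 mxE.
by rewrite (hess_gen _ x0_a0) Z scale0r addr0.
Qed.

Let hess_ex0 : e *m Dz x0 M u0 = (e *m Dz x0 al u0) 0 0 *: wh + fh.
Proof.
have Z : (e *m a0) 0 0 = 1 by rewrite e_a0 mxE.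
by rewrite (hess_gen _ x0_a0) Z scale1r.
Qed.

Let wh0 : wh != 0.
Proof.
apply/eqP => E; have := ww_neq0 u0; rewrite -/w0.
by rewrite -[w0](mulmxK uA) -/wh E mul0mx eqxx.
Qed.

Let B_herm w : U w -> (B w)^H = B w.
Proof. by move=> Uw; rewrite BE// !adjM adjK FS_herm// mulmxA. Qed.

Let eB : e *m B u0 = 0.
Proof. by rewrite BE// !mulmxA e_W !mul0mx. Qed.

(** The form B is pulled back by w, and e lies in the kernel of dw at u0: there
    B e^H is a product with the antiholomorphic factor (e dw)^H, which
    vanishes at u0. *)
Let DzB_e (x : 'rV[R[i]]_n) : x *m Dz x B u0 *m e^H = 0.
Proof.
have dB := msmooth_mdiff sB Uu0.
have dF : mdiff (fun w => W w *m FS Q (ww w)) u0.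
  by apply: mdiffM W_diff _; apply: FS_mdiff (ww_diff Uu0) _.
have dWe : mdiff (fun w => e *m W w) u0 by exact: mdiffM (mdiff_cst e u0) W_diff.
have E : \forall w \near u0, B w *m e^H = (W w *m FS Q (ww w)) *m (e *m W w)^H.
  by apply: (open_near oU Uu0) => w Uw; rewrite BE// adjM !mulmxA.
have D1 : Dz x (fun w => B w *m e^H) u0 = Dz x B u0 *m e^H.
  rewrite (DzM x dB (mdiff_cst _ _)).
  rewrite Dz_cst.
  by rewrite mulmx0 addr0.
have hb l : mdzb l (fun w => e *m W w) u0 = 0.
  by rewrite (mdzb_cstM _ _ W_diff) (mhol_mdzb0 _ W_hol Uu0) mulmx0.
have D4 := etrans (etrans (esym D1) (Dz_near x E)) (Dz_mul_adj0 x dF dWe e_W hb).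
by transitivity (x *m (Dz x B u0 *m e^H)); [rewrite mulmxA|rewrite D4 mulmx0].
Qed.

Let k := hnorm2 (H (m u0)) wh.
Let k_gt0 : 0 < k. Proof. by case: pH => _; apply. Qed.

Let G0 t := k%:C *: (a0 *m a0^H) + t%:C *: B u0.

(** A vector annihilated by dy_i is detected by dw, whose values have no
    component along w since their i-th entry is 0. *)
Let G0_pos t : 0 < t -> forall x, x != 0 -> 0 < hnorm2 (G0 t) x.
Proof.
move=> t0 x xn; rewrite hnorm2D_mx !hnorm2Z_mx.
have -> : hnorm2 (B u0) x = hnorm2 (FS Q w0) (x *m W u0).
  by rewrite !hnorm2E BE// adjM !mulmxA.
pose z := (x *m J) 0 i.
have -> : hnorm2 (a0 *m a0^H) x = complex.Re z ^+ 2 + complex.Im z ^+ 2.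
  have -> : hnorm2 (a0 *m a0^H) x = complex.Re (z * Num.conj z).
    rewrite hnorm2E (mulmxA x) -(mulmxA (x *m a0)) -adjM x_a0 -/z; congr complex.Re.
    by rewrite mul_scalar_mx scalemxE adjE [_%:M _ _]mxE eqxx mulr1n.
  by rewrite cReM cReJ cImJ mulrN opprK !expr2.
have Fge := FS_ge0 pQ (x *m W u0) (ww_neq0 u0).
have [z0|zn] := eqVneq z 0; last first.
  apply: ltr_pwDl (mulr_ge0 (ltW t0) Fge); apply: mulr_gt0 k_gt0 _.
  rewrite lt0r (addr_ge0 (sqr_ge0 _) (sqr_ge0 _)) andbT (paddr_eq0 (sqr_ge0 _) (sqr_ge0 _)).
  by rewrite !sqrf_eq0; move: zn; rewrite eq_complex.
have -> : complex.Re z ^+ 2 + complex.Im z ^+ 2 = 0 by rewrite z0 /= expr0n addr0.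
rewrite mulr0 add0r; apply: mulr_gt0 t0 _.
apply: (FS_gt0 pQ (ww_neq0 u0)) => c; apply/eqP => E.
have c0 : c = 0.
  by have := congr1 (fun v : 'rV[R[i]]_n => v 0 i) E; rewrite /= col_W eqxx scalemxE ww_i mulr1.
have xW : x *m W u0 = 0 by rewrite E c0 scale0r.
have xJ : x *m J = 0.
  apply/rowP => a; rewrite [RHS]mxE; have [->|ai] := eqVneq a i; first exact: z0.
  by have := col_W x a; rewrite (negPf ai) xW mxE => <-.
by move: xn; rewrite -[x](mulmxK uJ) xJ mul0mx eqxx.
Qed.

Let G0_unit t : 0 < t -> G0 t \in unitmx.
Proof.
move=> t0; apply: posdef_unit; split; last exact: G0_pos.
have Hh : (G0 t)^H = G0 t by rewrite /G0 adjD !adjZ !realC_conj adjM adjK B_herm.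
exact: Hh.
Qed.

(** The coordinate form of the theorem: y is the blowup chart, m the blowdown in
    the chart where the metric H is given, and T the transition to that chart
    from the one in which the blowdown is y_i w. *)
Theorem blowup_chart_negative : exists2 xi : 'rV[R[i]]_n, xi != 0 &
  exists2 t0 : R, 0 < t0 & forall t, 0 < t -> t < t0 -> forall G,
    (\forall w \near u0, G w = M w *m H (m w) *m (M w)^H + t%:C *: B w) ->
    complex.Re (curvature4 G u0 xi xi xi xi) < 0 /\ 0 < hnorm2 (G u0) xi.
Proof.
(* Derivatives of the metric along the image wh of w: since dm(xi) = r wh, those
   along xi are r and r^2 times these. *)
pose K1 := Dz wh H (m u0); pose K2 := DDb wh H (m u0).
have [r r0 sgn] := degenerate_curvature_lt0 K1 K2 (e *m Dz e M u0) pH wh0 f_indep.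
pose xi := r%:C *: e + x0.
have xi_a0 : xi *m a0 = r%:C%:M.
  by rewrite /xi mulmxDl -scalemxAl e_a0 x0_a0 addr0 scale_scalar_mx mulr1.
have xin : xi != 0.
  apply/eqP => E; have := xi_a0; rewrite E mul0mx => /matrixP/(_ 0 0).
  by rewrite !mxE /= mulr1n => /eqP; rewrite eq_sym (inj_eq (@complexI R)) gt_eqF.
exists xi => //.
pose eta := xi *m M u0; pose x1 := xi *m Dz xi M u0.
have etaE : eta = r%:C *: wh by rewrite /eta M0 mulmxA xi_a0 mul_scalar_mx.
pose c := 2 * r%:C * (e *m Dz x0 al u0) 0 0 + (x0 *m Dz x0 al u0) 0 0.
have x1E : x1 = c *: wh + (r%:C *: (2 *: fh) + (r ^+ 2)%:C *: (e *m Dz e M u0)).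
  rewrite /x1 {1}/xi mulmxDl -scalemxAl /xi DzD DzZ !mulmxDr -!scalemxAr.
  rewrite (Dz_jac_sym e x0 oU Uu0 hm) hess_x0x0 hess_ex0 /c.
  rewrite scalerDr scalerA -rmorphM -expr2.
  move: (e *m Dz e M u0) (wh) (fh) (_ 0 0) (_ 0 0) => Z w f p q.
  rewrite !scalerDr !scalerDl !scalerA.
  apply/matrixP => a b; rewrite !mxE; ring.
pose v := (x1 *m H (m u0) + (r ^+ 2)%:C *: (wh *m K1)) *m wh^H.
pose be := xi *m Dz xi B u0.
pose D := complex.Re ((be *m invmx (G0 1) *m be^H - xi *m DDb xi B u0 *m xi^H) 0 0).
have S := sgn x1 v c x1E erefl.
set E := complex.Re _ in S.
have t0_gt0 : 0 < - E / (`|D| + 1) by rewrite divr_gt0 ?oppr_gt0// ltr_wpDl.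
(* The curvature is E + t D, with E < 0 coming from the pulled-back metric alone. *)
exists (- E / (`|D| + 1)) => // t tpos tlt G GE.
have GE0 : G u0 = G0 t.
  by rewrite (nbhs_singleton GE) M0 (rank_one_sandwich _ _ (hH (UV Uu0))).
split; last by rewrite GE0; exact: G0_pos.
have dK w : U w -> mdiff (fun w => H (m w)) w.
  by move=> Uw; exact: (mdiff_pull hm Uw (msmooth_mdiff sH (UV Uw))).
have ddK l : mdiff (mdzb l (fun w => H (m w))) u0.
  exact: (mdiff_mdzb_pull oU hm oV UV sH l Uu0).
have hK w : U w -> (H (m w))^H = H (m w) by move=> Uw; exact/hH/UV.
have L1 : Dz xi (fun w => H (m w)) u0 = r%:C *: K1.
  by rewrite (Dz_pull hm xi Uu0) -/eta ?etaE ?DzZ//; exact: msmooth_mdiff sH (UV Uu0).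
have L2 : DDb xi (fun w => H (m w)) u0 = (r ^+ 2)%:C *: K2.
  rewrite (DDb_pull oU hm oV UV sH xi Uu0) -/eta etaE DDbZ realC_conj -rmorphM -expr2.
  by [].
have hB0 : (B u0)^H = B u0 by exact: B_herm.
have G1E : G0 1 = k%:C *: (a0 *m a0^H) + B u0 by rewrite /G0 scale1r.
have inv := degenerate_inverse_norm v (lt0r_neq0 k_gt0) e_a0 eB hB0 (DzB_e xi) (G0_unit tpos).
rewrite -G1E in inv; have {}inv := inv (G0_unit ltr01).
have cE : (x1 *m H (m u0) + r%:C *: wh *m (r%:C *: K1)) *m (M u0)^H
     + t%:C *: (xi *m Dz xi B u0) = v *m a0^H + t%:C *: be.
  rewrite M0 adjM mulmxA -scalemxAl -scalemxAr scalerA -rmorphM -expr2.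
  by [].
rewrite (curvature_two_terms oU Uu0 (jac_mhol oU hm) dK ddK hK sB B_herm GE
  erefl etaE L1 L2 GE0 cE).
rewrite inv.
have -> : complex.Re ((- (x1 *m (r%:C *: K1)^H *m (r%:C *: wh)^H +
       r%:C *: wh *m ((r ^+ 2)%:C *: K2) *m (r%:C *: wh)^H +
       x1 *m H (m u0) *m x1^H + r%:C *: wh *m (r%:C *: K1) *m x1^H) +
     ((k^-1)%:C *: (v *m v^H) + t%:C *: (be *m invmx (G0 1) *m be^H)) -
     t%:C *: (xi *m DDb xi B u0 *m xi^H)) 0 0) = E + t * D.
  by rewrite final_algebra addmxE scalemxE cReD cReMr.
exact: small_perturbation tpos tlt.
Qed.

End Model.

Transparent Dz Dzb DDb mdz mdzb hnorm2 FS.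

(** * The Fubini--Study form as a second derivative *)

Section Coordinates.
Context {R : realType} {n : nat}.
Implicit Types (u v : Cn R n) (j k a : 'I_n).

Lemma derive_linear_fun (f : Cn R n -> R) u v :
  (forall h, f (h *: v + u) = h * f v + f u) -> 'D_v f u = f v.
Proof.
move=> fE; rewrite /derive; apply: cvg_lim => //.
apply: (@cvg_trans _ (cst (f v) h @[h --> (0:R)^'])); last exact: cvg_cst.
apply: near_eq_cvg; near=> h => /=.
have h0 : h != 0 by near: h; exact: nbhs_dnbhs_neq.
by rewrite fE addrK /GRing.scale /= mulKf.
Unshelve. all: by end_near. Qed.

Lemma zvec_cD a u v : cD v (fun w => zvec w 0 a) u = zvec v 0 a.
Proof.
rewrite /cD /zvec.
have -> : (fun w : Cn R n => complex.Re ((\row_j (w.1 0 j +i* w.2 0 j)) 0 a)) = (fun w => w.1 0 a).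
  by apply/funext => w; rewrite mxE.
have -> : (fun w : Cn R n => complex.Im ((\row_j (w.1 0 j +i* w.2 0 j)) 0 a)) = (fun w => w.2 0 a).
  by apply/funext => w; rewrite mxE.
by rewrite !derive_linear_fun ?mxE// => h /=; rewrite !mxE.
Qed.

Lemma zvec_mdiff u : mdiff zvec u.
Proof.
move=> k a; rewrite ord1; split.
  have -> : (fun w : Cn R n => complex.Re (zvec w 0 a)) = (fun w => w.1 0 a).
    by apply/funext => w; rewrite mxE.
  have d1 : differentiable (@fst 'rV[R]_n 'rV[R]_n) u.
    by apply: linear_differentiable => y; exact: cvg_fst.
  exact: (differentiable_comp d1 (derive.differentiable_coord _ _ _)).
have -> : (fun w : Cn R n => complex.Im (zvec w 0 a)) = (fun w => w.2 0 a).
  by apply/funext => w; rewrite mxE.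
have d2 : differentiable (@snd 'rV[R]_n 'rV[R]_n) u.
  by apply: linear_differentiable => y; exact: cvg_snd.
exact: (differentiable_comp d2 (derive.differentiable_coord _ _ _)).
Qed.

Lemma zvec_re j a : zvec ((delta_mx 0 j, 0) : Cn R n) 0 a = (a == j)%:R.
Proof.
by rewrite !mxE eqxx /=; case: (a == j); apply: complex_ext.
Qed.

Lemma zvec_im j a : zvec ((0, delta_mx 0 j) : Cn R n) 0 a = 'i%C * (a == j)%:R.
Proof.
rewrite !mxE eqxx /=; case: (a == j) => /=; rewrite ?mulr1 ?mulr0 //.
Qed.

Lemma dz_zvec j a u : dz j (fun w => zvec w 0 a) u = (a == j)%:R.
Proof.
rewrite /dz !zvec_cD zvec_re zvec_im mulrA -expr2 sqr_i mulN1r opprK.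
move: ((a == j)%:R : R[i]) => x; rewrite -mulr2n -(mulr_natl x 2) mulrA mulVf ?mul1r// ?pnatr_eq0.
Qed.

Lemma dzb_zvec j a u : dzb j (fun w => zvec w 0 a) u = 0.
Proof.
by rewrite /dzb !zvec_cD zvec_re zvec_im mulrA -expr2 sqr_i mulN1r subrr mulr0.
Qed.

Lemma jac_id u : jac (fun w : Cn R n => w) u = 1%:M.
Proof. by apply/matrixP => j a; rewrite !mxE dz_zvec eq_sym. Qed.

Lemma mdz_zvec j u : mdz j zvec u = delta_mx 0 j.
Proof. by apply/rowP => a; rewrite mxE dz_zvec mxE eqxx. Qed.

Lemma mdzb_zvec j u : mdzb j zvec u = 0.
Proof. by apply/rowP => a; rewrite mxE dzb_zvec mxE. Qed.

End Coordinates.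

Section LogNorm.
Context {R : realType} {n : nat}.
Variable Q : 'M[R[i]]_n.
Hypothesis pQ : posdef Q.
Implicit Types (u v w : Cn R n) (j k : 'I_n).

Let N w := hnorm2 Q (zvec w).
Let hQ : Q^H = Q. Proof. by case: pQ. Qed.

Let NC w : (N w)%:C = (zvec w *m Q *m (zvec w)^H) 0 0.
Proof. by rewrite herm_val. Qed.

Let N_diff u : differentiable N u.
Proof. exact: hnorm2_differentiable (zvec_mdiff u). Qed.

Let zQ_diff u : mdiff (fun w => zvec w *m Q) u.
Proof. exact: mdiffM (zvec_mdiff u) (mdiff_cst Q u). Qed.

Let dzb_N k u : dzb k (fun w => (N w)%:C) u = (zvec u *m Q) 0 k.
Proof.
under eq_fun do rewrite NC.
transitivity (mdzb k (fun w => zvec w *m Q *m (zvec w)^H) u 0 0); first by rewrite mxE.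
rewrite (mdzbM k (zQ_diff u) (mdiff_adj (zvec_mdiff u))) (mdzb_adj k (zvec_mdiff u)).
rewrite (mdzbM k (zvec_mdiff u) (mdiff_cst Q u)) mdzb_zvec mul0mx add0r.
have -> : mdzb k (fun=> Q) u = 0 by apply/matrixP => a b; rewrite !mxE dzb_cst.
rewrite mulmx0 mul0mx add0r mdz_zvec.
have dE a : (delta_mx 0 k : 'rV[R[i]]_n)^H a 0 = (a == k)%:R.
  by rewrite adjE mxE eqxx /= rmorph_nat.
rewrite mxE (bigD1 k) //= big1 ?addr0 => [|a ak]; last first.
  by rewrite dE (negPf ak) mulr0.
by rewrite dE eqxx mulr1.
Qed.

Let dz_N j u : dz j (fun w => (N w)%:C) u = (Q *m (zvec u)^H) j 0.
Proof.
have -> : (fun w => (N w)%:C) = (fun w => Num.conj ((N w)%:C)).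
  by apply/funext => w; rewrite realC_conj.
rewrite (dz_conj _ (cdiff_real (N_diff u))) dzb_N -adjE adjM hQ.
by [].
Qed.

(** The derivative of ln N in the conjugate directions is (v Q) / N, and a second
    derivative gives Q / N - (Q v^H) (v Q) / N^2. *)
Lemma ddbar_log_norm2 u : zvec u != 0 -> ddbar (log_norm2 Q) u = FS Q (zvec u).
Proof.
move=> u0.
have Npos w : zvec w != 0 -> 0 < N w by case: pQ => _; apply.
have near0 : \forall w \near u, 0 < N w.
  have cN : {for u, continuous N} := differentiable_continuous (N_diff u).
  have : \forall z \near N u, 0 < z by exact: lt_nbhsr (Npos _ u0).
  by move=> /cN.
apply/matrixP => j k; rewrite mxE.
have E : \forall w \near u, dzb k (fun w => (log_norm2 Q w)%:C) w =
    ((N w)^-1)%:C * (zvec w *m Q) 0 k.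
  apply: filterS near0 => w Nw.
  by rewrite (dzb_rcomp k (N_diff w) (is_derive1_ln Nw)) dzb_N.
rewrite (dz_near j E).
have Nu := Npos _ u0; have Nn : N u != 0 by rewrite gt_eqF.
have dinv : is_derive (N u) 1 (fun x : R => x^-1) (- (N u) ^- 2).
  have -> : - (N u) ^- 2 = - (N u) ^- 2 *: (1 : R) by rewrite /GRing.scale /= mulr1.
  exact: (@is_deriveV _ id _ _ _ Nn (is_derive_id _ _)).
have d1 := cdiff_rcomp (N_diff u) dinv.
rewrite (dzM j d1 (zQ_diff u 0 k)) (dz_rcomp j (N_diff u) dinv) dz_N.
have -> : dz j (fun w => (zvec w *m Q) 0 k) u = Q j k.
  transitivity (mdz j (fun w => zvec w *m Q) u 0 k); first by rewrite mxE.
  rewrite (mdzM j (zvec_mdiff u) (mdiff_cst Q u)) mdz_zvec.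
  have -> : mdz j (fun=> Q) u = 0 by apply/matrixP => a b; rewrite !mxE dz_cst.
  by rewrite mulmx0 addr0 -rowE mxE.
rewrite /FS /defect scalemxE addmxE oppmxE scalemxE -/(N u).
have -> : (Q *m (zvec u)^H *m zvec u *m Q) j k = (Q *m (zvec u)^H) j 0 * (zvec u *m Q) 0 k.
  by rewrite -[_ *m zvec u *m Q]mulmxA mxE big_ord1.
rewrite rmorphN /= -exprVn rmorphXn /=.
move: ((N u)^-1%:C) (Q j k) ((Q *m _) j 0) ((zvec u *m Q) 0 k) => x a b c.
by rewrite mulrBr addrC; congr (_ + _); ring.
Qed.

End LogNorm.

Section JacobianChain.
Context {R : realType}.

Lemma jac_near n l (F F' : Cn R n -> Cn R l) u :
  (\forall w \near u, F w = F' w) -> jac F u = jac F' u.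
Proof.
move=> E; apply/matrixP => j a; rewrite !mxE; apply: dz_near.
by apply: filterS E => w ->.
Qed.

Lemma jac_comp n l p (F : Cn R n -> Cn R l) (G : Cn R l -> Cn R p) u :
  vdiff F u -> (forall a j, dzb j (fun w => zvec (F w) 0 a) u = 0) -> vdiff G (F u) ->
  jac (fun w => G (F w)) u = jac F u *m jac G (F u).
Proof.
move=> dF hF dG; apply/matrixP => j c; rewrite [LHS]mxE [RHS]mxE.
rewrite (dz_comp j dF (dG c)); apply: eq_bigr => a _.
by rewrite hF conjC0 mulr0 addr0 mulrC [jac F _ _ _]mxE [jac G _ _ _]mxE.
Qed.

End JacobianChain.

(** * Charts and changes of coordinates *)

Section Charts.
Context {R : realType} {n : nat} {X : topologicalType}.
Implicit Types (c : chart R n X) (u : Cn R n) (x : X) (O : set X).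

Lemma cimgK c u : is_chart c -> cimg c u -> cdom c (cinv c u) /\ cmap c (cinv c u) = u.
Proof. by move=> [_ _ cK _ _] [x cx <-]; rewrite cK. Qed.

Lemma chart_imageP c O u : is_chart c ->
  (cmap c @` (O `&` cdom c)) u <-> cimg c u /\ O (cinv c u).
Proof.
move=> hc; split=> [[x [Ox cx] <-]|[cu Ou]].
  by have [_ _ cK _ _] := hc; rewrite cK//; split=> //; exists x.
by have [cx xu] := cimgK hc cu; exists (cinv c u).
Qed.

Lemma chart_image_open c O : is_chart c -> open O -> open (cmap c @` (O `&` cdom c)).
Proof.
move=> hc oO; rewrite openE => u /(chart_imageP _ _ hc) [cu Ou].
have [_ oI _ _ cinvc] := hc.
have n1 : \forall w \near u, cimg c w by exact: open_nbhs_nbhs.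
have n2 : \forall w \near u, O (cinv c w).
  by apply: (cinvc u cu); exact: open_nbhs_nbhs.
by apply: filterS2 n1 n2 => w h1 h2; apply/(chart_imageP _ _ hc).
Qed.

End Charts.

Section HolSub.
Context {R : realType} {n : nat}.

Lemma hol_sub (U V : set (Cn R n)) (f : Cn R n -> R[i]) : V `<=` U -> hol U f -> hol V f.
Proof.
by move=> VU [s h]; split; [exact: csmooth_sub s|move=> u /VU; exact: h].
Qed.

Lemma holo_hol l (U : set (Cn R n)) (F : Cn R n -> Cn R l) : holo U F ->
  forall a, hol U (fun u => zvec (F u) 0 a).
Proof. by move=> h a; have [s d] := h a; split=> // u Uu j; exact: d. Qed.

Lemma hol_at l (U : set (Cn R n)) (F : Cn R n -> Cn R l) u :
  (forall a, hol U (fun u => zvec (F u) 0 a)) -> U u ->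
  vdiff F u /\ forall a j, dzb j (fun w => zvec (F w) 0 a) u = 0.
Proof.
move=> h Uu; split; first exact: (hol_vdiff h Uu).
by move=> a j; have [_ ->] := h a.
Qed.

End HolSub.

Section Forms.
Context {R : realType} {n : nat}.
Implicit Types (X Y Xh : cmanifold R n).

Lemma transition_jac X (x y : X) (u : Cn R n) : cimg (chart_at x) u -> cinv (chart_at x) u = y ->
  let F := cmap (chart_at y) \o cinv (chart_at x) in
  vdiff F u /\ forall a j, dzb j (fun w => zvec (F w) 0 a) u = 0.
Proof.
move=> xu uy F; have hc := chart_atP x.
have ht := holo_hol (chart_at_holo x y).
apply: (hol_at ht); rewrite setIC; apply/(chart_imageP _ _ hc); split=> //.
by rewrite uy; exact: mem_chart_at.
Qed.

(** Fields of forms are given in the frame of the preferred chart at each point,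
    so that pullbacks involve a different chart at every point; the chain rule
    replaces it by the chart at x. *)
Lemma jac_change_chart X l (Fn : X -> Cn R l) (x : X) (u : Cn R n) :
  cimg (chart_at x) u ->
  let y := cinv (chart_at x) u in
  vdiff (Fn \o cinv (chart_at y)) (cmap (chart_at y) y) ->
  jac (cmap (chart_at y) \o cinv (chart_at x)) u *m
    jac (Fn \o cinv (chart_at y)) (cmap (chart_at y) y) =
  jac (Fn \o cinv (chart_at x)) u.
Proof.
move=> xu y dF; have [dT hT] := @transition_jac X x y u xu erefl.
rewrite -(jac_comp dT hT dF); apply: jac_near.
have [_ _ yK _ _] := chart_atP y; have [_ oI _ _ cx] := chart_atP x.
have : \forall w \near u, cdom (chart_at y) (cinv (chart_at x) w).
  apply: (cx u xu); apply: open_nbhs_nbhs; split; last exact: mem_chart_at.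
  by have [] := chart_atP y.
by apply: filterS => w dw /=; rewrite yK.
Qed.

(** All charts chosen pointwise cancel: the coefficients of mu^*h are those of h
    composed with mu, multiplied by the Jacobian of mu between the two fixed charts. *)
Lemma form_coef_pullback X Xh (mu : Xh -> X) (h : hform X) (q : Xh) (p : X) (u : Cn R n) :
  holo_map setT mu -> cimg (chart_at q) u ->
  cdom (chart_at p) (mu (cinv (chart_at q) u)) ->
  let m := cmap (chart_at p) \o mu \o cinv (chart_at q) in
  form_coef (pullback mu h) (chart_at q) u =
  jac m u *m form_coef h (chart_at p) (m u) *m (jac m u)^H.
Proof.
move=> [cmu hmu] qu pu m.
pose x := cinv (chart_at q) u; pose z := mu x.
have [_ _ pK _ cpinv] := chart_atP p; have [_ _ _ _ cq] := chart_atP q.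
have zE : cinv (chart_at p) (m u) = z by rewrite /m /= pK.
have pmu : cimg (chart_at p) (m u) by exists z.
rewrite /form_coef /pullback zE -/x -/z.
set J1 := jac (cmap (chart_at x) \o cinv (chart_at q)) u.
set J2 := jac _ _.
set J3 := jac (cmap (chart_at z) \o cinv (chart_at p)) (m u).
have d2 : vdiff ((cmap (chart_at z) \o mu) \o cinv (chart_at x)) (cmap (chart_at x) x).
  refine (proj1 (hol_at (holo_hol (hmu x z)) _)).
  exists x => //; split; last exact: mem_chart_at.
  by split=> //; exact: mem_chart_at.
have E12 : J1 *m J2 = jac (cmap (chart_at z) \o mu \o cinv (chart_at q)) u.
  exact: (jac_change_chart qu d2).
have [dT hT] := transition_jac pmu zE.
have [dm hm] : vdiff m u /\ forall a j, dzb j (fun w => zvec (m w) 0 a) u = 0.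
  apply: (hol_at (holo_hol (hmu q p))).
  have [qx qxu] := cimgK (chart_atP q) qu.
  by exists x => //; split.
have E3 : jac m u *m J3 = jac (cmap (chart_at z) \o mu \o cinv (chart_at q)) u.
  rewrite -(jac_comp dm hm); last exact: (transition_jac pmu zE).1.
  apply: jac_near.
  have : \forall w \near u, cdom (chart_at p) (mu (cinv (chart_at q) w)).
    have n1 : nbhs z (cdom (chart_at p)).
      by apply: open_nbhs_nbhs; split=> //; have [] := chart_atP p.
    exact: (cq u qu _ (cmu x I _ n1)).
  by apply: filterS => w dw /=; rewrite pK.
transitivity ((J1 *m J2) *m h z *m (J1 *m J2)^H); first by rewrite adjM !mulmxA.
by rewrite E12 -E3 adjM !mulmxA.
Qed.

Lemma form_coef_pullback_Cn Xh l (s : Xh -> Cn R l) (G : Cn R l -> 'M[R[i]]_l) (b : hform Xh)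
    (q : Xh) (u : Cn R n) (A : set Xh) :
  cimg (chart_at q) u -> A (cinv (chart_at q) u) -> holo_fun A s ->
  b (cinv (chart_at q) u) = pullback_Cn s G (cinv (chart_at q) u) ->
  form_coef b (chart_at q) u = jac (s \o cinv (chart_at q)) u *m
     G (s (cinv (chart_at q) u)) *m (jac (s \o cinv (chart_at q)) u)^H.
Proof.
move=> qu Au hs bE; rewrite /form_coef bE /pullback_Cn.
set x := cinv (chart_at q) u in Au *.
have ds : vdiff (s \o cinv (chart_at x)) (cmap (chart_at x) x).
  refine (proj1 (hol_at (holo_hol (hs x)) _)).
  by exists x => //; split=> //; exact: mem_chart_at.
rewrite -(jac_change_chart qu ds) -/x.
by rewrite -!/(adj _) adjM !mulmxA.
Qed.

Lemma form_coef_add Xh (g1 g2 : hform Xh) (t : R) (c : chart R n Xh) u :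
  form_coef (fun x => g1 x + t%:C *: g2 x) c u = form_coef g1 c u + t%:C *: form_coef g2 c u.
Proof.
by rewrite /form_coef mulmxDr mulmxDl -scalemxAr -scalemxAl.
Qed.

Lemma form_coef_herm Xh (g : hform Xh) (c : chart R n Xh) u :
  (forall x, is_hermitian (g x)) -> (form_coef g c u)^H = form_coef g c u.
Proof.
move=> hg; rewrite /form_coef -!/(adj _) !adjM adjK mulmxA.
by congr (_ *m _ *m _); exact: hg.
Qed.

Lemma form_coef_self Xh (g : hform Xh) (x : Xh) :
  form_coef g (chart_at x) (cmap (chart_at x) x) = g x.
Proof.
have [_ oI xK _ _] := chart_atP x; have xx := mem_chart_at x.
rewrite /form_coef xK//.
have -> : jac (cmap (chart_at x) \o cinv (chart_at x)) (cmap (chart_at x) x) = 1%:M.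
  rewrite -(jac_id (cmap (chart_at x) x)); apply: jac_near.
  have : \forall w \near cmap (chart_at x) x, cimg (chart_at x) w.
    by apply: open_nbhs_nbhs; split=> //; exists x.
  by apply: filterS => w /(cimgK (chart_atP x)) [].
by rewrite trmx1 map_mx1 mul1mx mulmx1.
Qed.

End Forms.

(** * Negative curvature on the exceptional divisor *)

(** The two transition maps are inverse to each other near the point. *)
Lemma transition_unit (R : realType) n (X : topologicalType) (c d : chart R n X) (x : X) :
  is_chart c -> is_chart d -> holo_transition c d -> holo_transition d c ->
  cdom c x -> cdom d x -> jac (cmap d \o cinv c) (cmap c x) \in unitmx.
Proof.
move=> hc hd cd dc cx dx.
have [oc _ cK _ ccont] := hc; have [od _ dK _ _] := hd.
have [d1 h1] : vdiff (cmap d \o cinv c) (cmap c x) /\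
   forall a j, dzb j (fun w => zvec ((cmap d \o cinv c) w) 0 a) (cmap c x) = 0.
  by apply: (hol_at (holo_hol cd)); exists x.
have E1 : (cmap d \o cinv c) (cmap c x) = cmap d x by rewrite /= cK.
have d2 : vdiff (cmap c \o cinv d) ((cmap d \o cinv c) (cmap c x)).
  by rewrite E1; apply: (proj1 (hol_at (holo_hol dc) _)); exists x.
have E : jac (cmap d \o cinv c) (cmap c x) *m
    jac (cmap c \o cinv d) ((cmap d \o cinv c) (cmap c x)) = 1%:M.
  rewrite -(jac_comp d1 h1 d2) -(jac_id (cmap c x)); apply: jac_near.
  have xI : cimg c (cmap c x) by exists x.
  have nd : nbhs (cinv c (cmap c x)) (cdom d).
    by rewrite cK//; apply: open_nbhs_nbhs.
  have n1 : \forall w \near cmap c x, cdom d (cinv c w) by exact: (ccont _ xI _ nd).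
  have n2 : \forall w \near cmap c x, cimg c w.
    by apply: open_nbhs_nbhs; split=> //; have [] := hc.
  apply: filterS2 n1 n2 => w dw /(cimgK hc)[_ cw] /=.
  by rewrite dK.
exact: (proj1 (mulmx1_unit E)).
Qed.

Lemma Qball_nbhs (R : realType) n (Q : 'M[R[i]]_n) (r : R) : 0 < r ->
  \forall u \near (0 : Cn R n), Qball Q r u.
Proof.
move=> r0.
have dN := hnorm2_differentiable Q (zvec_mdiff (0 : Cn R n)).
have cN : {for (0 : Cn R n), continuous (fun w => hnorm2 Q (zvec w))} :=
  differentiable_continuous dN.
have Z : zvec (0 : Cn R n) = 0 by apply/rowP => j; rewrite !mxE; apply: complex_ext.
have : \forall z \near hnorm2 Q (zvec (0 : Cn R n)), z < r ^+ 2.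
  by apply: lt_nbhsl; rewrite Z hnorm2_0 exprn_gt0.
by move=> /cN.
Qed.

Theorem corollary3 (R : realType) (n : nat) (X Xh : cmanifold R n)
    (h : hform X) (p : X) (mu : Xh -> X)
    (phi : chart R n X) (L : Xh -> projsp R n)
    (Q : 'M[R[i]]_n) (r : R) (chi : Cn R n -> R)
    (b : hform Xh) (q : Xh)
    (hn : (1 < n)%N)
    (X_compact : compact [set: X])
    (h_kahler : kahler h)
    (mu_blowup : is_blowup p mu)
    (phi_centered : centered_chart p phi)
    (phi_L : blowup_over mu phi L)
    (Q_inner : posdef Q)
    (r_gt0 : 0 < r)
    (ball_fits : Qball Q r `<=` cimg phi)
    (chi_bump : is_bump Q (cimg phi) r chi)
    (b_form : is_form_b Q p mu phi L r chi b)
    (qE : exc_divisor p mu q) :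
  exists2 t0 : R, 0 < t0 &
    forall t : R, 0 < t -> t < t0 ->
      exists2 xi : 'rV[R[i]]_n, xi != 0 & hol_sec_curv (h_t mu h b t) q xi < 0.
Proof.
have [muh _ _] := mu_blowup; have [[phi_chart phi_tr] phi_p phi0] := phi_centered.
have [[h_herm h_smooth _] h_pos] := h_kahler.
have [[b_herm b_smooth _] b_FS _ _] := b_form.
have muq : mu q = p := qE.
have [_ charts] := phi_L.
have [i Lqi] : exists i : 'I_n, exists2 w, w \in sval (L q) & w 0 i != 0.
  have Lq0 : vpick (sval (L q)) != 0.
    by rewrite vpick0 -dimv_eq0 (eqP (svalP (L q))).
  have /rV0Pn[i wi] := Lq0.
  by exists i, (vpick (sval (L q))) => //; exact: memv_pick.
(* A second coordinate, along E. *)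
have [j0 ij] : exists j0 : 'I_n, j0 != i.
  have n0 : (0 < n)%N by exact: ltnW.
  have [i0|i0] := eqVneq (val i) 0%N.
    by exists (Ordinal hn); rewrite -val_eqE /= i0.
  by exists (Ordinal n0); rewrite -val_eqE /= eq_sym.
have [c [[c_chart c_tr] cdomE cE]] := charts i.
pose cq := chart_at q; pose cp := chart_at p.
have hcq : is_chart cq by exact: chart_atP.
have hcp : is_chart cp by exact: chart_atP.
have [oc _ cK ccont _] := c_chart.
have [ophi _ phiK phicont _] := phi_chart.
have [ocp _ cpK _ _] := hcp; have [ocq ocqI cqK _ cqcont] := hcq.
have [mu_cont mu_holo] := muh.
(* On O all charts in use are defined and b is the pulled-back Fubini-Study form. *)
pose O : set Xh := [set x | [/\ cdom c x, cdom cp (mu x), cdom phi (mu x)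
   & Qball Q r (cmap phi (mu x))]]°.
have OP x : O x -> [/\ cdom c x, cdom cp (mu x), cdom phi (mu x)
   & Qball Q r (cmap phi (mu x))] by move=> /interior_subset.
have oO : open O by exact: open_interior.
have cq_dom : cdom c q by rewrite cdomE; split=> //; rewrite muq.
have Oq : O q.
  have n1 : \forall x \near q, cdom c x by exact: open_nbhs_nbhs.
  have n2 : \forall x \near q, cdom cp (mu x).
    apply: (mu_cont q I); apply: open_nbhs_nbhs; split=> //.
    by rewrite muq; exact: mem_chart_at.
  have n3 : \forall x \near q, cdom phi (mu x).
    by apply: (mu_cont q I); apply: open_nbhs_nbhs; split=> //; rewrite muq.
  have n4 : \forall x \near q, Qball Q r (cmap phi (mu x)).
    have nb : nbhs (cmap phi (mu q)) (Qball Q r) by rewrite muq phi0; exact: Qball_nbhs.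
    have phq : cdom phi (mu q) by rewrite muq.
    exact: (mu_cont q I _ (phicont _ phq _ nb)).
  have : \forall x \near q, [/\ cdom c x, cdom cp (mu x), cdom phi (mu x)
     & Qball Q r (cmap phi (mu x))].
    by apply: filterS2 (filterI n1 n2) (filterI n3 n4) => x [? ?] [? ?]; split.
  exact.
pose U := cmap cq @` (O `&` cdom cq).
have UP u : U u -> cimg cq u /\ O (cinv cq u) by move=> /(chart_imageP _ _ hcq).
have oU : open U by exact: chart_image_open.
pose u0 := cmap cq q.
have Uu0 : U u0 by exists q => //; split=> //; exact: mem_chart_at.
have u0q : cinv cq u0 = q by rewrite /u0 cqK//; exact: mem_chart_at.
pose y := cmap c \o cinv cq.
pose m := cmap cp \o mu \o cinv cq.
pose T := cmap cp \o cinv phi.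
pose V0 := cmap phi @` (cdom cp `&` cdom phi).
pose H := form_coef h cp; pose B := form_coef b cq.
(* The local lift w of L that describes b near q. *)
pose sx (x : Xh) : Cn R n := cnvec (aff_gen i (zvec (cmap c x))).
pose g w : Cn R n := cnvec (zvec (y w) 0 i *: aff_gen i (zvec (y w))).
have gE w : U w -> g w = cmap phi (mu (cinv cq w)).
  move=> /UP[_ /OP[cx _ _ _]]; have [e1 _] := cE _ cx.
  by rewrite /g /y /= -[X in cnvec X]e1 zvecK.
have gu0 : g u0 = cmap phi p by rewrite gE// u0q muq.
have hy a : hol U (fun w => zvec (y w) 0 a).
  apply: (hol_sub _ (holo_hol (c_tr q).2 a)) => w /UP[cw /OP[cx _ _ _]].
  by rewrite setIC; apply/(chart_imageP _ _ hcq).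
have hm a : hol U (fun w => zvec (m w) 0 a).
  apply: (hol_sub _ (holo_hol (mu_holo q p) a)) => w /UP[cw /OP[_ px _ _]].
  have [dx xw] := cimgK hcq cw.
  by exists (cinv cq w).
have oV0 : open V0 by exact: chart_image_open.
have hT a : hol V0 (fun v => zvec (T v) 0 a).
  by have := holo_hol (phi_tr p).1 a; rewrite setIC.
have gV w : U w -> V0 (g w).
  move=> Uw; have [_ /OP[_ px fx _]] := UP _ Uw.
  by rewrite gE//; exists (mu (cinv cq w)).
have mE w : U w -> m w = T (g w).
  move=> Uw; have [_ /OP[_ px fx _]] := UP _ Uw.
  by rewrite gE// /T /= phiK.
have uJ : jac y u0 \in unitmx.
  apply: transition_unit => //; first exact: (c_tr q).2; first exact: (c_tr q).1.
  exact: mem_chart_at.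
have uA : jac T (g u0) \in unitmx.
  rewrite gu0; apply: transition_unit => //; first exact: (phi_tr p).1.
    exact: (phi_tr p).2.
  exact: mem_chart_at.
have Y0 : zvec (y u0) 0 i = 0.
  have := congr1 zvec gu0; rewrite cnvecK phi0 => /rowP/(_ i).
  rewrite !mxE eqxx mulr1 => ->.
  by apply: complex_ext.
have mu0 : m u0 = cmap cp p by rewrite /m /= u0q muq.
have UV w : U w -> cimg cp (m w).
  by move=> /UP[_ /OP[_ px _ _]]; exists (mu (cinv cq w)).
have oV : open (cimg cp) by have [] := hcp.
have sH : msmooth (cimg cp) H by move=> k l; exact: h_smooth.
have hH v : cimg cp v -> adj (H v) = H v by move=> _; exact: form_coef_herm.
have pH : posdef (H (m u0)) by rewrite mu0 /H /cp form_coef_self.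
have sB : msmooth U B.
  by move=> k l; apply: csmooth_sub (b_smooth q k l) => w /UP[].
have sx_holo : holo_fun O sx.
  move=> x a; have ha : hol (cmap (chart_at x) @` (O `&` cdom (chart_at x)))
      (fun u => zvec ((sx \o cinv (chart_at x)) u) 0 a).
    have [->|ai] := eqVneq a i.
      have -> : (fun u => zvec ((sx \o cinv (chart_at x)) u) 0 i) = (fun=> 1).
        by apply/funext => u; rewrite /sx /= cnvecK mxE eqxx.
      exact: hol_cst.
    have -> : (fun u => zvec ((sx \o cinv (chart_at x)) u) 0 a) =
        (fun u => zvec ((cmap c \o cinv (chart_at x)) u) 0 a).
      by apply/funext => u; rewrite /sx /= cnvecK mxE (negPf ai).
    apply: (hol_sub _ (holo_hol (c_tr x).2 a)) => w [z [/OP[cz _ _ _] zx] <-].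
    by exists z.
  by have [s1 s2] := ha; split=> // u Uu j; exact: s2.
have sx_line x : O x -> zvec (sx x) != 0 /\ sval (L x) = <[zvec (sx x)]>%VS.
  move=> /OP[cx _ _ _]; rewrite /sx cnvecK; have [_ ->] := cE _ cx; split=> //.
  by apply/eqP => /rowP/(_ i); rewrite !mxE eqxx => /eqP; rewrite oner_eq0.
have BE w : U w -> B w = jac (sx \o cinv cq) w *m FS Q (aff_gen i (zvec (y w)))
    *m adj (jac (sx \o cinv cq) w).
  move=> /UP[cw Ow].
  have bx := b_FS O sx oO _ sx_holo sx_line _ Ow.
  have sub : O `<=` [set x | cdom phi (mu x) /\ Qball Q r (cmap phi (mu x))].
    by move=> x /OP[_ _ ? ?].
  have e : ddbar (log_norm2 Q) (sx (cinv cq w)) = FS Q (aff_gen i (zvec (y w))).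
    by rewrite (ddbar_log_norm2 Q_inner (sx_line _ Ow).1) /sx cnvecK.
  have := form_coef_pullback_Cn cw Ow sx_holo (bx sub).
  by rewrite e.
have [xi xi0 [t0 t0pos neg]] := blowup_chart_negative Q_inner ij oU Uu0 hy hm oV0 hT gV mE
  uJ Y0 uA oV UV sH hH pH sB BE.
exists t0 => // t tpos tt0; exists xi => //.
have GE : \forall w \near u0, form_coef (h_t mu h b t) cq w =
    jac m w *m H (m w) *m adj (jac m w) + (real_complex_def (Phant R) t) *: B w.
  apply: (open_near oU Uu0) => w /UP[cw /OP[_ px _ _]].
  have P := @form_coef_pullback R n X Xh mu h q p w muh cw px.
  exact: etrans (form_coef_add (pullback mu h) b t cq w) (congr1 (fun A => A + _ *: B w) P).
have [neg1 pos1] := neg t tpos tt0 _ GE.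
rewrite /hol_sec_curv /hol_sec_coord pmulr_llt0//.
by rewrite invr_gt0 exprn_gt0.
Qed.
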